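(* Let $k$ be a field that is not algebraic over a finite subfield. Let $R$ be a $k$-algebra satisfying a polynomial identity, and suppose that $R$ is noncommutative modulo its prime radical (that is, the quotient of $R$ by its prime radical is a noncommutative ring). Then $R$ contains a free subsemigroup.
   Context: All rings and algebras are associative and unital. A $k$-algebra $R$ satisfies a polynomial identity if there is a nonzero polynomial $f$ in the free associative algebra $k\langle X_1,\ldots,X_m\rangle$, for some $m$, with $f(r_1,\ldots,r_m)=0$ for all $r_1,\ldots,r_m\in R$. The prime radical of $R$ is the intersection of all prime ideals of $R$. ''Free subsemigroup'' always means a multiplicative, noncyclic free subsemigroup: $R$ contains a free subsemigroup if there exist $x,y\in R$ such that the subsemigroup of $(R,\cdot)$ generated by $x$ and $y$ is free on $x,y$ (distinct nonempty words in $x,y$ give distinct elements of $R$). *)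

(* Defs.v *)
From HB Require Import structures.
From mathcomp Require Import all_boot all_order all_algebra.
From mathcomp Require Import monalg.

Set Implicit Arguments.
Unset Strict Implicit.
Unset Printing Implicit Defensive.

Import GRing.Theory.
Local Open Scope ring_scope.

(* A finite subfield is presented as the image of a (necessarily injective)    *)
(* ring morphism from a finite field; [algebraicOver phi x] says that x is a   *)
(* root of a nonzero polynomial with coefficients in that image.               *)
Definition algebraic_over_finite_subfield (k : fieldType) : Prop :=
  exists (F : finFieldType) (phi : {rmorphism F -> k}),
    forall x : k, algebraicOver phi x.

(* {malg k[{fmonom 'I_m}]}, the monoid algebra of the free monoid on 'I_m, is  *)
(* the free algebra k<X_1, ..., X_m>. The product follows the order of the     *)
(* letters of w.                                                               *)
Definition eval_word (R : nzRingType) (I : choiceType) (r : I -> R)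
    (w : {fmonom I}) : R :=
  \prod_(i <- (w : seq I)) r i.

Definition eval_free_alg (k : fieldType) (R : algType k) (m : nat)
    (r : 'I_m -> R) (f : {malg k[{fmonom 'I_m}]}) : R :=
  mmap (in_alg R) (eval_word r) f.

Definition satisfies_PI (k : fieldType) (R : algType k) : Prop :=
  exists (m : nat) (f : {malg k[{fmonom 'I_m}]}),
    f != 0 /\ forall r : 'I_m -> R, eval_free_alg r f = 0.

(* Subsets are Prop-valued: the ideals of ring_quotient are decidable and      *)
(* one-sided.                                                                  *)
Definition two_sided_ideal (R : nzRingType) (I : R -> Prop) : Prop :=
  [/\ I 0,
      forall x y, I x -> I y -> I (x - y),
      forall a x, I x -> I (a * x)
    & forall a x, I x -> I (x * a)].

(* As P is additively closed, the ideal product I J lies in P iff all the      *)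
(* products x * y with x in I and y in J do.                                   *)
Definition prime_ideal (R : nzRingType) (P : R -> Prop) : Prop :=
  [/\ two_sided_ideal P,
      ~ P 1
    & forall I J : R -> Prop, two_sided_ideal I -> two_sided_ideal J ->
        (forall x y, I x -> J y -> P (x * y)) ->
        (forall x, I x -> P x) \/ (forall y, J y -> P y)].

Definition prime_radical (R : nzRingType) (x : R) : Prop :=
  forall P : R -> Prop, prime_ideal P -> P x.

(* x * y and y * x have the same class modulo N iff N (x * y - y * x).         *)
Definition noncommutative_modulo (R : nzRingType) (N : R -> Prop) : Prop :=
  ~ (forall x y : R, N (x * y - y * x)).

(* Any realization of R / N as a ring is noncommutative exactly when R is      *)
(* noncommutative modulo N.                                                    *)
Lemma noncommutative_moduloP (R : nzRingType) (N : R -> Prop) (S : pzRingType)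
    (p : {rmorphism R -> S}) :
  (forall s : S, exists x : R, p x = s) -> (forall x : R, N x <-> p x = 0) ->
  noncommutative_modulo N <-> ~ commutative (@GRing.mul S).
Proof.
move=> p_surj kerp; split=> ncomm comm; apply: ncomm => x y.
  by apply/kerp; rewrite rmorphB !rmorphM comm subrr.
have [[a <-] [b <-]] := (p_surj x, p_surj y).
by apply/eqP; rewrite -subr_eq0 -!rmorphM -rmorphB; apply/eqP/kerp.
Qed.

(* The letters true and false stand for x and y. *)
Definition free_on (R : nzRingType) (x y : R) : Prop :=
  forall u v : {fmonom bool}, u <> [::] :> seq bool -> v <> [::] :> seq bool ->
    eval_word (fun b : bool => if b then x else y) u =
    eval_word (fun b : bool => if b then x else y) v -> u = v.

Definition contains_free_subsemigroup (R : nzRingType) : Prop :=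
  exists x y : R, free_on x y.

(* Main.v *)
Require Import Defs.
From HB Require Import structures.
From mathcomp Require Import all_boot all_order all_algebra all_field.
From mathcomp Require Import boolp.
From mathcomp Require classical_sets.
From mathcomp Require Import finmap monalg.

Set Implicit Arguments.
Unset Strict Implicit.
Unset Printing Implicit Defensive.

Import GRing.Theory.
Local Open Scope ring_scope.

(** Why the theorem holds. Fix a prime ideal P and r, s whose commutator w lies
    outside P. The proof has two halves: R is represented by matrices so that w
    survives, and the matrices are then specialized to a finite field, where
    two elements playing ping-pong can be chosen.

    Matrices. A polynomial identity yields a multilinear one
    ([PI_multilinear]). A multilinear identity forbids a nonzero nil right ideal
    modulo a prime ([nil_right_ideal_PI]), so some multiple c = w t is not
    nilpotent. Then 1 - cX has no left inverse in R[X]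
    ([polynomial_not_inverse]), and a maximal left ideal containing 1 - cX gives
    a simple R[X]-module V on which cX fixes a nonzero vector; thus w acts
    nontrivially on V. A maximal commuting set K of endomorphisms of V is a
    field, the operators generated by R and K are dense over K ([density]), and
    the identity bounds dim_K V ([mlact_not_identity]). This is a morphism rho
    from R to matrices over K whose image spans all matrices over K and does
    not commute ([PI_matrix_representation]).

    Free pair. Writing the matrix units as combinations of elements of rho(R)
    involves finitely many elements of K, which lie in the image of a ring
    C = Z[X_1, ..., X_m]; the kernel of C -> K is contained in the kernel of
    some morphism from C to a finite field E ([finite_specialization]). The
    matrices over C whose image over K lies in rho(R) reduce to a finite ring S
    which spans all matrices over E. As finite division rings commute, S has
    singular nonzero elements, and its elements of least rank provide e, f of
    the same rank, with distinct row spaces, such that every product of two of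
    them keeps that rank ([ping_pong_pair]). A word in e and f then has the row
    space of its last letter ([ping_pong_word]).
    Lift e and f to R. A relation between words in the lifts reduces to the
    same relation between e and f, so both words are empty or have the same
    last letter, and that letter can be cancelled provided the lifts are
    invertible over K ([ping_pong_free]). Invertibility is reached by adding the
    scalars (t^q - t) t^j, where q is the order of E and t in k has pairwise
    distinct powers: they vanish over E and take infinitely many values over K
    ([regular_lift]). In characteristic 0 take t = 2; in characteristic p, if
    every t in k satisfied some t^i = t^j with i != j, then k would be algebraic
    over F_p ([exists_nontorsion]). *)

(** * Multilinear identities *)

Section Multilinear.
Variables (k : fieldType) (I : finType).

(** A multilinear polynomial of degree n in the variables of D is the sum over
    j in D of (a multilinear polynomial in the other variables) * x_j. Unfolding
    this, it is given by the coefficients [a s], where s lists the variables of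
    a monomial from right to left. The value is applied to a vector, so that one
    definition covers elements of R acting on R or on a module, and operators
    which belong to no ring type; [sc] is the action of the coefficients. *)
Fixpoint mlact (V : nmodType) (sc : k -> V -> V) n (a : seq I -> k)
    (D : {set I}) (x : I -> V -> V) (v : V) : V :=
  if n is n'.+1 then
    \sum_(j in D) mlact sc n' (fun s => a (j :: s)) (D :\ j) x (x j v)
  else sc (a [::]) v.

Fixpoint ml_nonzero n (a : seq I -> k) (D : {set I}) : Prop :=
  if n is n'.+1 then
    exists2 j, j \in D & ml_nonzero n' (fun s => a (j :: s)) (D :\ j)
  else a [::] != 0.

Lemma eq_mlact (V : nmodType) (sc : k -> V -> V) n (a a' : seq I -> k)
    (D : {set I}) (x x' : I -> V -> V) v :
    a =1 a' -> (forall j, j \in D -> x j =1 x' j) ->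
  mlact sc n a D x v = mlact sc n a' D x' v.
Proof.
elim: n => [|n IHn] in a a' D v * => /= aa' xx'; first by rewrite aa'.
apply: eq_bigr => j jD; rewrite xx' //.
by apply: IHn => [s|i /setD1P[_ iD]]; [apply: aa' | apply: xx'].
Qed.

Lemma mlact0 (R : algType k) n (a : seq I -> k) (D : {set I}) x (v : R) :
  (forall s, size s = n -> a s = 0) -> mlact *:%R n a D x v = 0.
Proof.
elim: n a D v => [|n IHn] a D v a0 /=; first by rewrite a0 ?scale0r.
by rewrite big1 // => j _; apply: IHn => s sn; rewrite a0 //= sn.
Qed.

Lemma mlact_sum (R : algType k) (T : Type) (W : seq T) (c : T -> k)
    (a : T -> seq I -> k) n (D : {set I}) x (v : R) :
  mlact *:%R n (fun s => \sum_(w <- W) c w * a w s) D x v =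
    \sum_(w <- W) c w *: mlact *:%R n (a w) D x v.
Proof.
elim: n a D v => [|n IHn] a D v /=.
  by rewrite scaler_suml; apply: eq_bigr => w _; rewrite scalerA.
under eq_bigr => j _ do rewrite (IHn (fun w s => a w (j :: s))).
by rewrite exchange_big /=; apply: eq_bigr => w _; rewrite scaler_sumr.
Qed.

(** Let y name a letter for each index. Substituting the sum of the x_j with
    y_j = i for the letter i, a word of length |I| contributes, to the part
    multilinear in the x_j, the sum of the products of the x_j over all
    orderings of I that spell the word. Inclusion-exclusion over the subsets J
    of I, keeping only the x_j with j in J, extracts this multilinear part and
    kills the shorter words. *)
Section Linearization.
Variables (R : algType k) (L : choiceType) (y : I -> L) (x : I -> R).

Let pr (J : {set I}) (s : seq L) : R :=
  \prod_(i <- s) \sum_(j in J | y j == i) x j.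

Let Delta (D : {set I}) (s : seq L) : R :=
  \sum_(J : {set I} | J \subset D) (-1) ^+ #|D :\: J| * pr J s.

Let Delta_splitE (D : {set I}) (s : seq L) j : j \in D ->
  \sum_(J : {set I} | (J \subset D) && (j \in J)) (-1) ^+ #|D :\: J| * pr J s
    = Delta D s + Delta (D :\ j) s.
Proof.
move=> jD; rewrite /Delta [in RHS](bigID (fun J : {set I} => j \in J)) /=.
rewrite -addrA -[LHS]addr0; congr (_ + _); apply/esym/eqP.
rewrite addr_eq0 -sumrN; apply/eqP; apply: eq_big => [J|J /andP[JD jJ]].
  by rewrite subsetD1.
rewrite -mulNr; congr (_ * _).
rewrite (cardsD1 j (D :\: J)) inE jD jJ add1n exprS mulN1r; congr (- (_ ^+ #|pred_of_set _|)).
by apply/setP => i; rewrite !inE; do ?case: (_ \in _); rewrite ?andbF ?andbT.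
Qed.

(* The Leibniz rule for Delta: for words of the maximal length the first term
   vanishes by Delta_small and the recursion defining mlact remains. *)
Let Delta_rcons D s i :
  Delta D (rcons s i) =
    \sum_(j in D | y j == i) (Delta D s + Delta (D :\ j) s) * x j.
Proof.
transitivity (\sum_(J : {set I} | J \subset D) \sum_(j in D | (y j == i) && (j \in J))
    (-1) ^+ #|D :\: J| * pr J s * x j).
  apply: eq_bigr => J JD; rewrite /pr -cats1 big_cat big_seq1 /= mulrA mulr_sumr.
  apply: eq_bigl => j; case jJ: (j \in J); rewrite /= ?andbF ?andbT //.
  by rewrite (subsetP JD).
rewrite (exchange_big_dep (fun j => (j \in D) && (y j == i))) /=; last first.
  by move=> J j _ /and3P[-> ->].
apply: eq_bigr => j /andP[jD yj]; rewrite -Delta_splitE // mulr_suml.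
by apply: eq_bigl => J; rewrite jD yj.
Qed.

Let Delta_small (D : {set I}) (s : seq L) : (size s < #|D|)%N -> Delta D s = 0.
Proof.
elim/last_ind: s D => [|s i IHs] D.
  rewrite card_gt0 => /set0Pn[j jD].
  rewrite /Delta (bigID (fun J : {set I} => j \in J)) /=.
  rewrite (reindex_onto (fun J => j |: J) (fun J => J :\ j)) /=; last first.
    by move=> J /andP[_ jJ]; rewrite setD1K.
  apply/eqP; rewrite addr_eq0 -sumrN; apply/eqP; apply: eq_big => [J|J].
    rewrite setU11 andbT subUset sub1set jD /=; congr andb.
    apply/eqP/idP => [<-|jJ]; first by rewrite setD11.
    by rewrite setU1K.
  move=> /andP[_ /eqP JJ]; have jJ : j \notin J by rewrite -JJ setD11.
  rewrite /pr !big_nil !mulr1.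
  rewrite (cardsD1 j (D :\: J)) inE jD jJ add1n exprS mulN1r opprK.
  congr (_ ^+ #|pred_of_set _|); apply/setP => i; rewrite !inE.
  by case: eqP; rewrite ?andbF.
rewrite size_rcons => sD; rewrite Delta_rcons big1 // => j /andP[jD _].
rewrite !IHs ?addr0 ?mul0r //; last exact: ltnW.
by move: sD; rewrite (cardsD1 j) jD add1n ltnS.
Qed.

(* Monomials of mlact are read from right to left, words from left to right. *)
Definition word_coef (a : seq L -> k) (s : seq I) : k := a (rev (map y s)).

Let Delta_word n (D : {set I}) (s : seq L) t : (size s <= n)%N -> #|D| = n ->
  Delta D s * t =
    mlact *:%R n (word_coef (fun u => (u == s)%:R)) D (fun j r => x j * r) t.
Proof.
elim: n D s t => [|n IHn] D s t.
  rewrite leqn0 => /nilP-> /eqP; rewrite cards_eq0 => /eqP->.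
  rewrite /Delta /= /word_coef /rev /= scale1r (big_pred1 set0) => [|J].
    by rewrite setD0 cards0 /pr big_nil !mul1r.
  by rewrite subset0.
case/lastP: s => [_|s i].
  move=> Dn; rewrite Delta_small ?Dn // mul0r mlact0 // => u su.
  rewrite /word_coef; case: eqP => // /(congr1 size).
  by rewrite size_rev size_map su.
rewrite size_rcons ltnS => sn Dn.
rewrite Delta_rcons /= mulr_suml big_mkcondr /=; apply: eq_bigr => j jD.
have Djn : #|D :\ j| = n by apply/eqP; rewrite -eqSS -Dn (cardsD1 j D) jD.
case: (y j =P i) => [yj|/eqP yj].
  rewrite Delta_small ?Dn ?ltnS // add0r -mulrA (IHn _ s) //.
  apply: eq_mlact => // u; rewrite /word_coef /= rev_cons yj eqseq_rcons.
  by rewrite eqxx andbT.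
rewrite mlact0 // => u _.
by rewrite /word_coef map_cons rev_cons eqseq_rcons (negPf yj) andbF.
Qed.

Lemma linearized_identity (f : seq L -> k) (W : seq (seq L)) (t : R) :
    (forall u, u \in W -> (size u <= #|I|)%N) ->
    (forall r : L -> R, \sum_(u <- W) f u *: \prod_(i <- u) r i = 0) ->
  mlact *:%R #|I| (word_coef (fun u => \sum_(w <- W) f w * (u == w)%:R)) [set: I]
    (fun j r => x j * r) t = 0.
Proof.
move=> szW fW0.
transitivity (\sum_(u <- W) f u *: (Delta setT u * t)).
  rewrite mlact_sum; apply: eq_big_seq => u uW; congr (_ *: _).
  by rewrite (@Delta_word #|I|) ?cardsT // szW.
under eq_bigr => u _ do rewrite mulr_suml scaler_sumr.
rewrite exchange_big big1 // => J _ /=.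
under eq_bigr => u _ do rewrite scalerAl scalerAr.
by rewrite -mulr_suml -mulr_sumr fW0 mulr0 mul0r.
Qed.

End Linearization.

Lemma ml_nonzero_path n (a : seq I -> k) (D : {set I}) s :
  uniq s -> size s = n -> {subset s <= D} -> a s != 0 -> ml_nonzero n a D.
Proof.
elim: n a D s => [|n IHn] a D [|j s] //= /andP[js Us] [sn] sD as0.
exists j; first by apply: sD; rewrite mem_head.
apply: IHn as0 => // i is_; rewrite !inE sD ?inE ?is_ ?orbT // andbT.
by apply: contraNneq js => <-.
Qed.

End Multilinear.

(** Linearize the given identity f along a word w of maximal length in f: the
    ordering of the indices that spells w has the coefficient of w in f, so the
    multilinear identity obtained is nonzero. *)
Lemma PI_multilinear (k : fieldType) (R : algType k) : satisfies_PI R ->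
  exists n (a : seq 'I_n -> k), ml_nonzero n a setT /\
    forall (x : 'I_n -> R) t, mlact *:%R n a setT (fun j r => x j * r) t = 0.
Proof.
move=> [m [f [f0 fR]]].
have [w [wf wmax]] : exists w, w \in msupp f /\
    forall u, u \in msupp f -> (size u <= size w)%N.
  have /fset0Pn[w0 w0f] : msupp f != fset0 by rewrite msupp_eq0.
  have [w _ wmax] :=
    @arg_maxnP _ (FSetSub w0f) xpredT (fun u => size (val u)) isT.
  exists (val w); split=> [|u uf]; first exact: valP.
  exact: (wmax (FSetSub uf) isT).
pose y (j : 'I_(size w)) := tnth (in_tuple w) j.
pose W := [seq val u | u <- msupp f].
pose c u := f@_(FMonom u).
exists (size w), (word_coef y (fun u => \sum_(v <- W) c v * (u == v)%:R)); split.
  apply: (@ml_nonzero_path _ _ _ _ _ (rev (enum 'I_(size w)))).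
  - by rewrite rev_uniq enum_uniq.
  - by rewrite size_rev size_enum_ord.
  - by move=> j; rewrite inE.
  rewrite /word_coef map_rev revK.
  have -> : [seq y i | i <- enum 'I_(size w)] = w.
    exact: (map_tnth_enum (in_tuple w)).
  rewrite big_map (big_fsetD1 w) //= eqxx mulr1 big1_fset /= => [|u].
    by rewrite addr0 /c mcoeff_neq0; case: (w) wf.
  by rewrite in_fsetD1 => /andP[uw _] _; rewrite (inj_eq val_inj) eq_sym (negPf uw) mulr0.
move=> x t; rewrite -[n in mlact _ n]card_ord.
apply: linearized_identity => [u /mapP[v vf ->]|r]; first by rewrite card_ord wmax.
rewrite big_map -[RHS](fR r) /eval_free_alg mmapE; apply: eq_bigr => u _.
by rewrite mulr_algl /c; case: u.
Qed.

(** * Nil right ideals of a prime PI ring *)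

Section PrimeIdeal.
Variables (k : fieldType) (R : algType k) (P : R -> Prop).
Hypothesis prP : prime_ideal P.

Lemma prime_ideal_elem x y : (forall r, P (x * r * y)) -> P x \/ P y.
Proof.
case: prP => -[P0 PB Pl Pr] P1 prod xRy.
pose I z := forall r, P (z * r * y).
pose J v := forall z r, I z -> P (z * r * v).
have idI : two_sided_ideal I.
  split=> [r|u v Iu Iv r|a u Iu r|a u Iu r].
  - by rewrite !mul0r.
  - by rewrite !mulrBl; apply: PB.
  - by rewrite -!mulrA; apply: Pl; rewrite mulrA.
  - by rewrite -(mulrA u).
have idJ : two_sided_ideal J.
  split=> [z r _|u v Ju Jv z r Iz|a u Ju z r Iz|a u Ju z r Iz].
  - by rewrite mulr0.
  - by rewrite mulrBr; apply: PB; [apply: Ju | apply: Jv].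
  - by rewrite mulrA -(mulrA z); apply: Ju.
  - by rewrite mulrA; apply/Pr/Ju.
have [z v Iz Jv|IP|JP] := prod I J idI idJ.
- by rewrite -[z]mulr1; apply: Jv.
- by left; apply: IP.
- by right; apply: JP => z r Iz; apply: Iz.
Qed.

Let P0 : P 0. Proof. by case: prP => -[]. Qed.
Let Pl a x : P x -> P (a * x). Proof. by case: prP => -[_ _ H _] _ _; apply: H. Qed.
Let Pr a x : P x -> P (x * a). Proof. by case: prP => -[_ _ _ H] _ _; apply: H. Qed.
Let PB x y : P x -> P y -> P (x - y).
Proof. by case: prP => -[_ H _ _] _ _; apply: H. Qed.
Let PD x y : P x -> P y -> P (x + y).
Proof. by move=> Px Py; rewrite -[y]opprK -[- y]sub0r; do 2?apply: PB. Qed.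
Let PZ c x : P x -> P (c *: x).
Proof. by move=> Px; rewrite -mulr_algl; apply: Pl. Qed.
Let Psum (I : Type) (s : seq I) (Q : pred I) F :
  (forall i, Q i -> P (F i)) -> P (\sum_(i <- s | Q i) F i).
Proof. by move=> PF; apply: big_ind. Qed.

Lemma mlact_ideal (I : finType) n a (D : {set I}) x t :
  P t -> P (mlact *:%R n a D (fun j r => x j * r) t).
Proof.
elim: n a D t => [|n IHn] a D t Pt /=; first exact: PZ.
by apply: Psum => j _; apply/IHn/Pl.
Qed.

Lemma mlact_mulr (I : finType) n a (D : {set I}) x (t u : R) :
  mlact *:%R n a D (fun j r => x j * r) (t * u)
    = mlact *:%R n a D (fun j r => x j * r) t * u.
Proof.
elim: n a D t => [|n IHn] a D t /=; first by rewrite scalerAl.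
by rewrite mulr_suml; apply: eq_bigr => j _; rewrite mulrA IHn.
Qed.

(** In each monomial x_j = r b is followed by some x_i = b u, or by the argument
    b t, so a factor b b u or b b t appears. *)
Lemma mlact_kill (I : finType) (T : R -> Prop) b r n a (D : {set I}) x j t :
    (forall t r, T t -> T (t * r)) -> (forall t, T t -> P (b * b * t)) ->
    (forall i, i != j -> exists2 u, T u & x i = b * u) -> x j = r * b ->
    #|D| = n -> j \in D -> T t ->
  P (mlact *:%R n a D (fun j r => x j * r) (b * t)).
Proof.
move=> Tr b2T xT xj; elim: n a D t => [|n IHn] a D t Dn jD Tt /=.
  by move/eqP: Dn; rewrite cards_eq0 => /eqP D0; rewrite D0 inE in jD.
apply: Psum => i iD; have [->|ij] := eqVneq i j.
  by apply: mlact_ideal; rewrite xj -mulrA (mulrA b b); apply/Pl/b2T.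
have [u Tu ->] := xT i ij; rewrite -mulrA; apply: IHn; last exact: Tr.
  by apply/eqP; rewrite -eqSS -Dn (cardsD1 i D) iD.
by rewrite !inE eq_sym ij.
Qed.

(** Induction on the degree of the identity, all modulo P. The identity is only
    required to hold after multiplication by elements of T on the right; this
    weakening is what passes to smaller degree. If T is not in P, nilpotency
    gives b in T with b b T in P but b T not in P. Substituting r b (r in T)
    for x_j and elements of b T for the other variables kills all monomials not
    ending in x_j; primeness then removes the factor r b from the rest. So
    the right ideal b T satisfies the identity formed by the monomials ending
    in x_j, whose degree is smaller. *)
Lemma nil_right_ideal_PI (I : finType) n a (D : {set I}) (T : R -> Prop) :
    #|D| = n -> ml_nonzero n a D ->
    (forall t r, T t -> T (t * r)) ->
    (forall t, T t -> exists m, P (t ^+ m)) ->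
    (forall x t, (forall j, T (x j)) -> T t ->
      P (mlact *:%R n a D (fun j r => x j * r) t)) ->
  forall t, T t -> P t.
Proof.
elim: n a D T => [|n IHn] a D T Dn /=.
  move=> a0 Tr _ idT t Tt.
  have := PZ (a [::])^-1 (idT (fun=> t) t (fun=> Tt) Tt).
  by rewrite scalerA mulVf // scale1r.
move=> [j jD nz] Tr nilT idT t Tt; apply: contrapT => nPt.
have [r ntrt] : exists r, ~ P (t * r * t).
  by apply/not_existsP => h; case: (prime_ideal_elem (fun r => contrapT (h r))).
pose t0 := t * r; have Tt0 : T t0 by apply: Tr.
(* b = t0 ^+ m for the last m with t0 ^+ m * T not contained in P; m > 0. *)
pose A m := `[< forall u, T u -> P (t0 ^+ m * u) >].
have exA : exists m, A m.
  by have [m Pm] := nilT _ Tt0; exists m; apply/asboolP => u Tu; apply: Pr.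
case: (ex_minnP exA) => -[|[|N]] /asboolP AN minN.
- by case: nPt; rewrite -[t]mul1r; apply: AN.
- by case: ntrt; apply: AN.
pose b := t0 ^+ N.+1.
have Tb : T b by rewrite /b exprS; apply: Tr.
have [t1 Tt1 nPbt1] : exists2 t1, T t1 & ~ P (b * t1).
  apply: contrapT => h; suff : (N.+1 < N.+1)%N by rewrite ltnn.
  apply: minN; apply/asboolP => u Tu; apply: contrapT => nP.
  by apply: h; exists u.
have b2T u : T u -> P (b * b * u).
  by move=> Tu; rewrite /b -exprD addSnnS exprD -mulrA; apply/Pl/AN.
pose T' u := exists2 v, T v & u = b * v.
have T'T u : T' u -> T u by case=> v _ ->; apply: Tr.
apply: (nPbt1); apply: (IHn _ (D :\ j) T' _ nz).
- by apply/eqP; rewrite -eqSS -Dn (cardsD1 j D) jD.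
- by move=> _ s [v Tv ->]; exists (v * s); [apply: Tr | rewrite mulrA].
- by move=> u /T'T; apply: nilT.
- move=> x s xT' /T'T Ts.
  have [|//|Pbt1] := @prime_ideal_elem
      (mlact *:%R n (fun s => a (j :: s)) (D :\ j) (fun j r => x j * r) s) (b * t1).
    move=> r1.
    pose x' i := if i == j then s * r1 * b else x i.
    have Tx' i : T (x' i) by rewrite /x'; case: eqP => _; [apply/Tr/Tr | apply/T'T/xT'].
    have x'T' i : i != j -> T' (x' i) by rewrite /x' => /negPf->.
    have x'j : x' j = s * r1 * b by rewrite /x' eqxx.
    have := idT x' t1 Tx' Tt1; rewrite /= (bigD1 j) //= => Psm.
    set S := (X in P (_ + X)) in Psm; have PS : P S.
      apply: Psum => i /andP[iD ij].
      have [v Tv ->] := x'T' i ij; rewrite -mulrA.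
      apply: (mlact_kill _ Tr b2T x'T' x'j); last exact: Tr.
        by apply/eqP; rewrite -eqSS -Dn (cardsD1 i D) iD.
      by rewrite !inE eq_sym ij.
    have := PB Psm PS; rewrite addrK x'j -!mulrA mlact_mulr.
    rewrite (@eq_mlact _ _ _ _ _ _ _ _ _ (fun i r => x i * r) _ (fun=> erefl)) //.
    by move=> i /setD1P[ij _] u; rewrite /x' (negPf ij).
  by case: nPbt1.
- by exists t1.
Qed.
End PrimeIdeal.

(** * Density over a maximal commuting set of endomorphisms *)

(** V is a module over R together with an endomorphism z; in the application it
    is an R[X]-module and z is the action of X. *)
Section Density.
Variables (k : fieldType) (R : algType k) (V : lmodType R) (z : V -> V).

Definition invariant (W : V -> Prop) : Prop :=
  [/\ forall u v, W u -> W v -> W (u - v), forall r v, W v -> W (r *: v)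
    & forall v, W v -> W (z v)].

Definition endo (f : V -> V) : Prop :=
  [/\ forall u v, f (u - v) = f u - f v, forall r v, f (r *: v) = r *: f v
    & forall v, f (z v) = z (f v)].

Definition maximal_commuting (F : (V -> V) -> Prop) : Prop :=
  forall g, F g <-> endo g /\ forall h, F h -> forall v, g (h v) = h (g v).

(** Zorn's lemma on commuting sets, not on subrings: a maximal commuting set is
    its own commutant, and this makes it a subring closed under inverses. *)
Lemma exists_maximal_commuting : exists F, maximal_commuting F.
Proof.
pose comm (A : classical_sets.set (V -> V)) := (forall f, A f -> endo f) /\
  forall f g, A f -> A g -> forall v, f (g v) = g (f v).
have [|F [[Fe Fc] Fmax]] := @classical_sets.Zorn_bigcup _ comm.
  move=> CC CCc tot; split=> [f [A CA Af]|f g [A CA Af] [B CB Bg]].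
    by have [Ae _] := CCc A CA; apply: Ae.
  have [AB|BA] := tot A B CA CB.
    by have [_ Bc] := CCc B CB; apply: Bc => //; apply: AB.
  by have [_ Ac] := CCc A CA; apply: Ac => //; apply: BA.
exists F => g; split=> [Fg|[ge gc]]; first by split; [apply: Fe | move=> h; apply: Fc].
apply: contrapT => nFg; apply: (Fmax (fun f => F f \/ f = g)).
  by split=> [f Ff|FgF]; [left | apply/nFg/FgF; right].
split=> [f [/Fe //|-> //]|f h [Ff|->] [Fh|->] v] //.
- exact: (Fc f h).
- by rewrite gc.
- exact: gc.
Qed.

Hypothesis z_endo : endo z.
Hypothesis V_simple : forall W, invariant W -> forall u, W u -> u != 0 ->
  forall v, W v.
Variable F : (V -> V) -> Prop.
Hypothesis F_max : maximal_commuting F.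

Lemma scalB g u v : F g -> g (u - v) = g u - g v.
Proof. by case/F_max => -[+ _ _] _; apply. Qed.
Lemma scalZ g r v : F g -> g (r *: v) = r *: g v.
Proof. by case/F_max => -[_ + _] _; apply. Qed.
Lemma scal0 g : F g -> g 0 = 0.
Proof. by move=> Fg; rewrite -[0 in LHS](subrr 0) (scalB _ _ Fg) subrr. Qed.
Lemma scalD g u v : F g -> g (u + v) = g u + g v.
Proof.
move=> Fg; have gN w : g (- w) = - g w.
  by rewrite -sub0r (scalB _ _ Fg) (scal0 Fg) sub0r.
by rewrite -[v in LHS]opprK (scalB _ _ Fg) gN opprK.
Qed.
Lemma scalC g h v : F g -> F h -> g (h v) = h (g v).
Proof. by move=> /F_max[_ gC] Fh; apply: (gC h Fh v). Qed.

Lemma scal_id : F id.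
Proof. by apply/F_max; split. Qed.

Lemma scal_z : F z.
Proof.
by apply/F_max; split=> // h /F_max[[_ _ hz] _] v; rewrite hz.
Qed.

Lemma scal_sub g h : F g -> F h -> F (fun v => g v - h v).
Proof.
move=> Fg Fh; apply/F_max; split=> [|f Ff v]; last first.
  by rewrite (scalB _ _ Ff) (scalC v Fg Ff) (scalC v Fh Ff).
have [zB _ _] := z_endo.
case/F_max: (Fg) => -[gB gZ gz] _; case/F_max: (Fh) => -[hB hZ hz] _.
split=> [u v|r v|v].
- by rewrite gB hB !opprD addrACA.
- by rewrite gZ hZ scalerBr.
- by rewrite gz hz zB.
Qed.

Lemma scal_comp g h : F g -> F h -> F (fun v => g (h v)).
Proof.
move=> Fg Fh; apply/F_max; split=> [|f Ff v]; last first.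
  by rewrite (scalC _ Fh Ff) (scalC _ Fg Ff).
case/F_max: (Fg) => -[gB gZ gz] _; case/F_max: (Fh) => -[hB hZ hz] _.
by split=> [u v|r v|v]; rewrite ?hB ?gB ?hZ ?gZ ?hz ?gz.
Qed.

(** Schur's lemma; the inverse commutes with F, hence lies in F. *)
Lemma scal_inv f v0 : F f -> f v0 != 0 -> exists2 g, F g & forall v, g (f v) = v.
Proof.
move=> Ff fv0; case/F_max: (Ff) => -[fB fZ fz] _.
have fI : injective f.
  move=> u v fuv; apply/eqP; rewrite -subr_eq0; apply: contraNT fv0 => uv.
  apply/eqP; apply: (@V_simple (fun v => f v = 0) _ _ _ uv).
    split=> [a b fa fb|r a fa|a fa]; rewrite ?fB ?fZ ?fz ?fa ?fb ?subrr ?scaler0 //.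
    exact: scal0 scal_z.
  by rewrite fB fuv subrr.
have /choice[g gK] v : exists u, f u = v.
  apply: (@V_simple (fun v => exists u, f u = v) _ _ _ fv0); last by exists v0.
  split=> [_ _ [a <-] [b <-]|r _ [a <-]|_ [a <-]].
  - by exists (a - b).
  - by exists (r *: a).
  - by exists (z a).
exists g => [|v]; last by apply: fI.
apply/F_max; split=> [|h Fh v]; last by apply: fI; rewrite gK (scalC _ Ff Fh) gK.
split=> [u v|r v|v]; apply: fI; rewrite ?fB ?fZ ?fz !gK //.
Qed.

(** The ring of operators generated by the actions of R and of F. *)
Inductive operator : (V -> V) -> Prop :=
| operator0 : operator (fun=> 0)
| operatorD f r g : F f -> operator g -> operator (fun v => f (r *: v) + g v).

Lemma operator_add g h : operator g -> operator h -> operator (fun v => g v + h v).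
Proof.
move=> + Gh; elim=> [|f r {}g Ff _ IHg].
  by under eq_fun do rewrite add0r.
by under eq_fun do rewrite -addrA; apply: operatorD.
Qed.

Lemma operator_act f r g : F f -> operator g -> operator (fun v => f (r *: g v)).
Proof.
move=> Ff; elim=> [|h s {}g Fh _ IHg].
  by under eq_fun do rewrite scaler0 (scal0 Ff); apply: operator0.
under eq_fun do rewrite scalerDr (scalD _ _ Ff) -(scalZ _ _ Fh) scalerA.
exact: (operatorD _ (scal_comp Ff Fh)).
Qed.

Lemma operator_comp g h : operator g -> operator h -> operator (fun v => g (h v)).
Proof.
move=> + Gh; elim=> [|f r {}g Ff _ IHg]; first exact: operator0.
by apply: operator_add => //; apply: operator_act.
Qed.

Lemma operatorB g u v : operator g -> g (u - v) = g u - g v.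
Proof.
elim=> [|f r {}g Ff _ IHg]; first by rewrite subr0.
by rewrite scalerBr (scalB _ _ Ff) IHg opprD addrACA.
Qed.

Lemma operator_scal g f v : operator g -> F f -> g (f v) = f (g v).
Proof.
move=> + Ff; elim=> [|h r {}g Fh _ IHg]; first by rewrite (scal0 Ff).
by rewrite (scalD _ _ Ff) IHg -(scalZ _ _ Ff) (scalC _ Fh Ff).
Qed.

Lemma operator_g0 g : operator g -> g 0 = 0.
Proof. by move=> Gg; rewrite -[0 in LHS](subrr 0) (operatorB _ _ Gg) subrr. Qed.

Lemma operator_gD g u v : operator g -> g (u + v) = g u + g v.
Proof.
move=> Gg; have gN w : g (- w) = - g w.
  by rewrite -sub0r (operatorB _ _ Gg) (operator_g0 Gg) sub0r.
by rewrite -[v in LHS]opprK (operatorB _ _ Gg) gN opprK.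
Qed.

Lemma operator_id : operator id.
Proof.
have := operatorD 1 scal_id operator0.
by under eq_fun do rewrite scale1r addr0.
Qed.

Lemma operator_scal1 f : F f -> operator f.
Proof.
move=> Ff; have := operator_act 1 Ff operator_id.
by under eq_fun do rewrite scale1r.
Qed.

Lemma operator_sub g h : operator g -> operator h -> operator (fun v => g v - h v).
Proof.
move=> Gg Gh; apply: operator_add => //.
have := operator_act (-1) scal_id Gh.
by under eq_fun do rewrite scaleN1r.
Qed.

Lemma operator_transitive u v : u != 0 -> exists2 g, operator g & g u = v.
Proof.
move=> u0; apply: (@V_simple (fun v => exists2 g, operator g & g u = v) _ u) => //.
  split=> [_ _ [g Gg <-] [h Gh <-]|r _ [g Gg <-]|_ [g Gg <-]].
  - by exists (fun v => g v - h v) => //; apply: operator_sub.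
  - by exists (fun v => r *: g v) => //; apply: (operator_act _ scal_id).
  - by exists (fun v => z (g v)) => //; apply/operator_comp/Gg/operator_scal1/scal_z.
by exists id => //; apply: operator_id.
Qed.

(** Linear combinations with coefficients in F, head first: this shape lets the
    density theorem go through by induction on the list. *)
Fixpoint span (s : seq V) (u : V) : Prop :=
  if s is a :: s' then exists2 f, F f & span s' (u - f a) else u = 0.

Lemma span0 s : span s 0.
Proof.
elim: s => //= a s IHs; exists (fun v => v - v); first exact: scal_sub scal_id scal_id.
by rewrite !subrr.
Qed.

Lemma span_killed s u g :
  operator g -> span s u -> (forall x, x \in s -> g x = 0) -> g u = 0.
Proof.
move=> Gg; elim: s u => [|a s IHs] u /=; first by move=> ->; rewrite (operator_g0 Gg).
move=> [f Ff su] gs.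
have := IHs _ su (fun x xs => gs x (mem_behead (s := a :: s) xs)).
by rewrite (operatorB _ _ Gg) (operator_scal _ Gg Ff) (gs a (mem_head _ _)) (scal0 Ff) subr0.
Qed.

(** Jacobson density. If all operators killing s and a also kill u, then
    g a |-> g u, for g killing s, is a well-defined endomorphism f commuting with
    F, hence an element of F; every operator killing s kills u - f a, so u - f a
    is in the span of s by induction. *)
Lemma density s u w : ~ span s u ->
  exists g, [/\ operator g, forall x, x \in s -> g x = 0 & g u = w].
Proof.
elim: s u w => [|a s IHs] u w /=.
  by move=> /eqP /(operator_transitive w)[g Gg gu]; exists g.
move=> nspan; have [sa|nsa] := pselect (span s a).
  have [|g [Gg gs gu]] := IHs u w.
    move=> su; case: nspan; exists (fun v => v - v); first exact: (scal_sub scal_id scal_id).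
    by rewrite !subrr subr0.
  exists g; split=> // x; rewrite inE => /predU1P[->|/gs//].
  exact: span_killed sa gs.
apply: contrapT => nex.
have killu g : operator g -> (forall x, x \in s -> g x = 0) -> g a = 0 -> g u = 0.
  move=> Gg gs ga; apply: contrapT => /eqP /(operator_transitive w)[h Gh hgu].
  apply: nex; exists (fun v => h (g v)); split=> //; first exact: operator_comp.
  by move=> x; rewrite inE => /predU1P[->|/gs->]; rewrite ?ga (operator_g0 Gh).
pose J g := operator g /\ forall x, x \in s -> g x = 0.
have JB g h : J g -> J h -> J (fun v => g v - h v).
  move=> [Gg gs] [Gh hs]; split=> [|x xs]; first exact: operator_sub.
  by rewrite gs ?hs ?subrr.
have JC g h : operator h -> J g -> J (fun v => h (g v)).
  by move=> Gh [Gg gs]; split=> [|x xs]; [apply: operator_comp | rewrite gs ?(operator_g0 Gh)].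
have /choice[gam gamP] v : exists g, J g /\ g a = v.
  by have [g [Gg gs ga]] := IHs a v nsa; exists g.
pose f v := gam v u.
have fE g : J g -> f (g a) = g u.
  move=> Jg; have [Jga ga] := gamP (g a); apply/eqP; rewrite -subr_eq0; apply/eqP.
  have [Gd ds] := JB _ _ Jga Jg; apply: (killu (fun v => gam (g a) v - g v)) => //.
  by rewrite ga subrr.
have Ff : F f.
  apply/F_max; split=> [|h Fh v]; last first.
    have [Jv gv] := gamP v; rewrite -{1}gv -[h _]/((fun x => h (gam v x)) a) fE //.
    by apply: JC => //; apply: operator_scal1.
  split=> [v v'|r v|v].
  - have [Jv gv] := gamP v; have [Jv' gv'] := gamP v'.
    by rewrite -{1}gv -{1}gv' -[_ - _]/((fun x => gam v x - gam v' x) a) fE //; apply: JB.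
  - have [Jv gv] := gamP v; rewrite -{1}gv -[r *: _]/((fun x => r *: gam v x) a) fE //.
    by apply: (JC _ (fun v => r *: v)) => //; apply: (operator_act _ scal_id operator_id).
  - have [Jv gv] := gamP v; rewrite -{1}gv -[z _]/((fun x => z (gam v x)) a) fE //.
    by apply: JC => //; apply/operator_scal1/scal_z.
apply: nspan; exists f => //; apply: contrapT => nsp.
have [g [Gg gs gu]] := IHs _ (u - f a) nsp.
apply: nsp; rewrite -gu (operatorB _ _ Gg) (operator_scal _ Gg Ff) fE // subrr.
exact: span0.
Qed.

(** Each vector lies outside the span of the later ones. *)
Fixpoint indep (s : seq V) : Prop :=
  if s is a :: s' then ~ span s' a /\ indep s' else True.

Lemma density_seq s (t : V -> V) : indep s ->
  exists2 g, operator g & forall x, x \in s -> g x = t x.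
Proof.
elim: s => [|a s IHs] /=; first by exists (fun=> 0); first exact: operator0.
move=> [/density nsa /IHs[g Gg gs]]; have [h [Gh hs ha]] := nsa (t a - g a).
exists (fun v => g v + h v); first exact: operator_add.
move=> x; rewrite inE => /predU1P[->|xs]; first by rewrite ha addrC subrK.
by rewrite gs // hs // addr0.
Qed.

Section Identity.
Variables (I : finType).
Let sc (c : k) (v : V) := c%:A *: v.

(** A staircase, as with matrix units: the variable x_j maps u to the vector
    found for the other variables and kills s, while the other variables kill u
    and s. Only the monomials ending in x_j survive at u, and the lower
    coefficients are handled by induction. *)
Lemma mlact_not_identity n a (D : {set I}) s :
    (forall s, indep s -> exists u, ~ span s u) ->
    #|D| = n -> ml_nonzero n a D -> indep s ->
  exists x u, [/\ forall j, operator (x j), forall j v, v \in s -> x j v = 0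
    & mlact sc n a D x u != 0].
Proof.
move=> inf; elim: n a D s => [|n IHn] a D s Dn /= nz inds.
  have [u nsu] := inf s inds; exists (fun _ _ => 0), u.
  split=> [j|//|]; first exact: operator0.
  rewrite /sc; apply: contra_not_neq nsu => au0.
  have -> : u = (a [::])^-1%:A *: ((a [::])%:A *: u).
    by rewrite scalerA -scalerAl mul1r scalerA mulVf // !scale1r.
  by rewrite au0 scaler0; apply: span0.
case: nz => j jD nz; have [u nsu] := inf s inds.
have Djn : #|D :\ j| = n by apply/eqP; rewrite -eqSS -Dn (cardsD1 j D) jD.
have [|x [v [Gx xs nzx]]] := IHn _ _ (u :: s) Djn nz; first by [].
have [g [Gg gs gu]] := density v nsu.
pose x' i := if i == j then g else x i.
exists x', u; split=> [i|i w ws|].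
- by rewrite /x'; case: eqP.
- by rewrite /x'; case: eqP => _; [apply: gs | apply/xs/mem_behead].
rewrite (bigD1 j) //= big1 => [|i /andP[iD ij]].
  rewrite addr0 {2}/x' eqxx gu (@eq_mlact _ _ _ _ _ _ _ _ _ x _ (fun=> erefl)) //.
  by move=> i /setD1P[ij _] w; rewrite /x' (negPf ij).
have Gx' l : operator (x' l) by rewrite /x'; case: eqP.
rewrite {2}/x' (negPf ij) xs ?mem_head //.
elim: (n) (fun s => a (i :: s)) (D :\ i) => [|m IHm] b E /=; first by rewrite /sc scaler0.
by rewrite big1 // => l _; rewrite (operator_g0 (Gx' l)).
Qed.

Let upd (x : I -> V -> V) j g i := if i == j then g else x i.

Let operator_pure r : operator ( *:%R r).
Proof. exact: (operator_act r scal_id operator_id). Qed.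

Lemma mlact_linear n a (D : {set I}) x f u v : (forall j, operator (x j)) -> F f ->
  mlact sc n a D x (f u + v) = f (mlact sc n a D x u) + mlact sc n a D x v.
Proof.
move=> Gx Ff; elim: n a D u v => [|n IHn] a D u v /=.
  by rewrite /sc scalerDr (scalZ _ _ Ff).
rewrite (big_morph f (fun u v => scalD u v Ff) (scal0 Ff)) -big_split.
by apply: eq_bigr => j _; rewrite (operator_gD _ _ (Gx j)) (operator_scal _ (Gx j) Ff) IHn.
Qed.

(** Linearity in each operator, which is why multilinear identities are used. *)
Lemma mlact_multilinear n a (D : {set I}) x j f g h v :
    (forall j, operator (x j)) -> operator g -> operator h -> F f ->
    #|D| = n -> j \in D ->
  mlact sc n a D (upd x j (fun v => f (g v) + h v)) v =
    f (mlact sc n a D (upd x j g) v) + mlact sc n a D (upd x j h) v.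
Proof.
move=> Gx Gg Gh Ff; elim: n a D v => [|n IHn] a D v Dn jD /=.
  by move/eqP: Dn; rewrite cards_eq0 => /eqP D0; rewrite D0 inE in jD.
rewrite (big_morph f (fun u v => scalD u v Ff) (scal0 Ff)) -big_split /=.
apply: eq_bigr => i iD; rewrite {2 4 6}/upd; have [->|ij] := eqVneq i j.
  have updE w u : mlact sc n (fun s => a (j :: s)) (D :\ j) (upd x j w) u
      = mlact sc n (fun s => a (j :: s)) (D :\ j) x u.
    by apply: eq_mlact => // l /setD1P[lj _] t; rewrite /upd (negPf lj).
  by rewrite !updE mlact_linear.
apply: IHn; last by rewrite !inE eq_sym ij.
by apply/eqP; rewrite -eqSS -Dn (cardsD1 i D) iD.
Qed.

(** The identity passes from R to the operators generated by R and F, replacing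
    one variable at a time. *)
Lemma mlact_operator n a : #|I| = n ->
    (forall (r : I -> R) v, mlact sc n a setT (fun j v => r j *: v) v = 0) ->
  forall x, (forall j, operator (x j)) -> forall v, mlact sc n a setT x v = 0.
Proof.
move=> In idR x Gx.
suff main (s : seq I) y : (forall j, operator (y j)) ->
    (forall j, j \notin s -> exists r, y j = *:%R r) ->
    forall v, mlact sc n a setT y v = 0.
  by apply: (main (enum I)) => // j; rewrite mem_enum.
elim: s y {x Gx} => [|j s IHs] y Gy pure v.
  have /choice[r yr] j : exists r, y j = *:%R r by apply: pure.
  by rewrite -[RHS](idR r v); apply: eq_mlact => // l _ u; rewrite yr.
have Gupd g : operator g -> forall l, operator (upd y j g l).
  by move=> Gg l; rewrite /upd; case: eqP.
have lin g h f := @mlact_multilinear n a setT y j f g h v Gy.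
suff: forall g, operator g -> mlact sc n a setT (upd y j g) v = 0.
  move=> /(_ _ (Gy j)) <-; apply: eq_mlact => // l _ u.
  by rewrite /upd; case: eqP => [->|].
move=> g; elim=> [|f r {}g Ff Gg IHg].
  have := lin _ _ _ operator0 operator0 scal_id; rewrite cardsT In inE addr0.
  move=> /(_ erefl isT) /eqP; rewrite -subr_eq subrr => /eqP/esym.
  by [].
rewrite (lin _ _ _ (operator_pure r)) ?cardsT ?inE // IHg addr0 IHs ?(scal0 Ff) //.
  exact: Gupd.
move=> l ls; rewrite /upd; case: (l =P j) => [_|/eqP lj]; first by exists r.
by apply: pure; rewrite inE negb_or lj.
Qed.

End Identity.

(** * The field of scalars and matrix coordinates *)

Hypothesis V_neq0 : exists v : V, v != 0.

Record scalar := Scalar { scalar_fun :> V -> V; scalar_prop : F scalar_fun }.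

HB.instance Definition _ := gen_eqMixin scalar.
HB.instance Definition _ := gen_choiceMixin scalar.

Lemma scalar_ext (a b : scalar) : a =1 b -> a = b.
Proof.
case: a b => [f Ff] [g Fg] /= /funext fg; move: Ff Fg; rewrite fg => Ff Fg.
by congr Scalar; apply: Prop_irrelevance.
Qed.

Let zeroS := Scalar (scal_sub scal_id scal_id).
Let subS (a b : scalar) := Scalar (scal_sub (scalar_prop a) (scalar_prop b)).
Let oppS a := subS zeroS a.
Let addS a b := subS a (oppS b).
Let oneS := Scalar scal_id.
Let mulS (a b : scalar) := Scalar (scal_comp (scalar_prop a) (scalar_prop b)).

Let addSE a b v : addS a b v = a v + b v.
Proof. by rewrite /= subrr sub0r opprK. Qed.
Let zeroSE v : zeroS v = 0.
Proof. exact: subrr. Qed.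
Let oppSE a v : oppS a v = - a v.
Proof. by rewrite /= subrr sub0r. Qed.

Let addSA : associative addS.
Proof. by move=> a b c; apply: scalar_ext => v; rewrite !addSE addrA. Qed.
Let addSC : commutative addS.
Proof. by move=> a b; apply: scalar_ext => v; rewrite !addSE addrC. Qed.
Let add0S : left_id zeroS addS.
Proof. by move=> a; apply: scalar_ext => v; rewrite addSE zeroSE add0r. Qed.
Let addNS : left_inverse zeroS oppS addS.
Proof. by move=> a; apply: scalar_ext => v; rewrite addSE zeroSE oppSE addNr. Qed.

HB.instance Definition _ := GRing.isZmodule.Build scalar addSA addSC add0S addNS.

Let mulSA : associative mulS.
Proof. by move=> a b c; apply: scalar_ext. Qed.
Let mulSC : commutative mulS.
Proof.
by move=> a b; apply: scalar_ext => v; apply: (scalC _ (scalar_prop a) (scalar_prop b)).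
Qed.
Let mul1S : left_id oneS mulS.
Proof. by move=> a; apply: scalar_ext. Qed.
Let mulSD : left_distributive mulS addS.
Proof.
by move=> a b c; apply: scalar_ext => v; rewrite addSE -![mulS _ _ v]/(_ (c v)) addSE.
Qed.
Let oneS_neq0 : oneS != 0.
Proof.
have [v v0] := V_neq0; apply: contra_neq v0 => /(congr1 (fun a : scalar => a v)).
by rewrite zeroSE.
Qed.

HB.instance Definition _ := GRing.Zmodule_isComNzRing.Build scalar
  mulSA mulSC mul1S mulSD oneS_neq0.

Let inv_exists (a : scalar) :
  exists b : scalar, (a != 0 -> mulS b a = oneS) /\ (a = 0 -> b = 0).
Proof.
have [->|a0] := eqVneq a 0; first by exists 0; split.
have [v av] : exists v, a v != 0.
  apply: contrapT => h; case/eqP: a0; apply: scalar_ext => v; rewrite zeroSE.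
  by apply: contrapT => /eqP av; apply: h; exists v.
have [g Fg gK] := scal_inv (scalar_prop a) av.
exists (Scalar Fg); split=> [_|/eqP]; first exact: scalar_ext.
by rewrite (negPf a0).
Qed.

Let invS (a : scalar) : scalar := projT1 (cid (inv_exists a)).
Let mulVS (a : scalar) : a != 0 -> invS a * a = 1.
Proof. by move=> a0; rewrite /invS; case: cid => b [H H0]; apply: H. Qed.
Let invS0 : invS 0 = 0.
Proof. by rewrite /invS; case: cid => b [H0 H]; apply: H. Qed.

HB.instance Definition _ := GRing.ComNzRing_isField.Build scalar mulVS invS0.

Lemma scalarD (a b : scalar) v : (a + b) v = a v + b v. Proof. exact: addSE. Qed.
Lemma scalarN (a : scalar) v : (- a) v = - a v. Proof. exact: oppSE. Qed.
Lemma scalarM (a b : scalar) v : (a * b) v = a (b v).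
Proof. reflexivity. Qed.
Lemma scalar0 v : (0 : scalar) v = 0. Proof. exact: zeroSE. Qed.
Lemma scalar_vD (a : scalar) u v : a (u + v) = a u + a v.
Proof. exact: (scalD _ _ (scalar_prop a)). Qed.
Lemma scalar_v0 (a : scalar) : a 0 = 0.
Proof. exact: (scal0 (scalar_prop a)). Qed.
Lemma scalar_vZ (a : scalar) r v : a (r *: v) = r *: a v.
Proof. exact: (scalZ _ _ (scalar_prop a)). Qed.

Definition comb (s : seq V) (c : nat -> scalar) : V :=
  \sum_(j < size s) c j (nth 0 s j).

Lemma comb_cons a s c : comb (a :: s) c = c 0%N a + comb s (fun j => c j.+1).
Proof. by rewrite /comb big_ord_recl. Qed.

Lemma spanP s u : span s u <-> exists c, u = comb s c.
Proof.
elim: s u => [|a s IHs] u.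
  split=> [->|[c ->]]; last by rewrite /comb big_ord0.
  by exists (fun=> 0); rewrite /comb big_ord0.
split=> [[f Ff /IHs[c uc]]|[c ->]].
  exists (fun j => if j is j'.+1 then c j' else Scalar Ff).
  by rewrite comb_cons -uc addrC subrK.
rewrite comb_cons; exists (c 0%N); first exact: scalar_prop.
by apply/IHs; exists (fun j => c j.+1); rewrite addrAC subrr add0r.
Qed.

Lemma comb_scale s (a : scalar) c : a (comb s c) = comb s (fun j => a * c j).
Proof.
by rewrite /comb (big_morph a (scalar_vD a) (scalar_v0 a)).
Qed.

Lemma indep_comb s c : indep s -> comb s c = 0 -> forall j, (j < size s)%N -> c j = 0.
Proof.
elim: s c => [//|a s IHs] c [nsa inds]; rewrite comb_cons => csum.
have c0 : c 0%N = 0.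
  apply: contra_notP nsa => /eqP c0; apply/spanP.
  exists (fun j => - (c 0%N)^-1 * c j.+1); rewrite -comb_scale.
  have -> : comb s (fun j => c j.+1) = (- c 0%N) a.
    by apply/eqP; rewrite scalarN -addr_eq0 addrC csum.
  by rewrite -scalarM mulrNN mulVf.
move=> [//|j] js; apply: (IHs (fun j => c j.+1)) => //.
by rewrite -[RHS]csum c0 scalar0 add0r.
Qed.

Lemma exists_basis (I : finType) n (a : seq I -> k) : #|I| = n ->
    ml_nonzero n a setT ->
    (forall (r : I -> R) v,
      mlact (fun c (v : V) => c%:A *: v) n a setT (fun j v => r j *: v) v = 0) ->
  exists2 s, indep s & forall u, span s u.
Proof.
move=> In nz idR; apply: contrapT => nbasis.
have [||||x [u [Gx _]]] := @mlact_not_identity I n a setT [::] => //.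
- move=> s inds; apply: contrapT => h; apply: nbasis; exists s => // u.
  by apply: contrapT => nsu; apply: h; exists u.
- by rewrite cardsT.
- by rewrite (mlact_operator In idR Gx) eqxx.
Qed.

Section Coordinates.
Variables (n : nat) (s : seq V).
Hypotheses (size_s : size s = n.+1) (inds : indep s) (spans : forall u, span s u).

Let lc (c : 'cV[scalar]_n.+1) : V := \sum_j c j 0 (nth 0 s j).

Let lc_comb (c : nat -> scalar) : lc (\col_j c j) = comb s c.
Proof. by rewrite /comb size_s; apply: eq_bigr => j _; rewrite mxE. Qed.

Let lcB c d : lc (c - d) = lc c - lc d.
Proof.
rewrite /lc -sumrB; apply: eq_bigr => j _.
by rewrite !mxE scalarD scalarN.
Qed.

Let lcZ a c : lc (a *: c) = a (lc c).
Proof.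
rewrite /lc (big_morph a (scalar_vD a) (scalar_v0 a)).
by apply: eq_bigr => j _; rewrite mxE.
Qed.

Let lc_sum (J : Type) (w : seq J) d : lc (\sum_(i <- w) d i) = \sum_(i <- w) lc (d i).
Proof.
have lc0 : lc 0 = 0 by rewrite -(subrr 0) lcB subrr.
apply: (big_morph lc _ lc0) => c1 c2.
by rewrite -[c2 in LHS]opprK lcB -[- c2]sub0r lcB lc0 sub0r opprK.
Qed.

Let lc_inj : injective lc.
Proof.
move=> c d cd; apply/eqP; rewrite -subr_eq0; apply/eqP/colP => j; rewrite [RHS]mxE.
have := @indep_comb s (fun i => (c - d) (inord i) 0) inds _ j.
rewrite inord_val size_s; apply=> //; rewrite -lc_comb.
have -> : \col_i (c - d) (inord i) 0 = c - d by apply/colP => i; rewrite mxE inord_val.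
by rewrite lcB cd subrr.
Qed.

Let coo_exists u : exists c, lc c = u.
Proof. by have /spanP[c ->] := spans u; exists (\col_j c j); rewrite lc_comb. Qed.

Let coo u := projT1 (cid (coo_exists u)).
Let cooK u : lc (coo u) = u. Proof. exact: projT2 (cid (coo_exists u)). Qed.

Let rho r : 'M[scalar]_n.+1 := \matrix_(i, j) coo (r *: nth 0 s j) i 0.

Let lc_rho r c : lc (rho r *m c) = r *: lc c.
Proof.
have -> : rho r *m c = \sum_j c j 0 *: coo (r *: nth 0 s j).
  apply/colP => i; rewrite mxE summxE; apply: eq_bigr => j _.
  by rewrite !mxE mulrC.
rewrite lc_sum scaler_sumr.
by apply: eq_bigr => j _; rewrite lcZ cooK scalar_vZ.
Qed.

Let eq_rho A B : (forall c, lc (A *m c) = lc (B *m c)) -> A = B :> 'M[scalar]_n.+1.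
Proof.
move=> AB; apply/trmx_inj/row_matrixP => i; rewrite -!tr_col; congr _^T.
by apply: lc_inj; rewrite !colE.
Qed.

Let rhoB : zmod_morphism rho.
Proof. by move=> r t; apply: eq_rho => c; rewrite mulmxBl lcB !lc_rho scalerBl. Qed.

Let rhoM : monoid_morphism rho.
Proof.
split=> [|r t]; apply: eq_rho => c; first by rewrite lc_rho mul1mx scale1r.
by rewrite -mulmxA !lc_rho scalerA.
Qed.

HB.instance Definition _ := GRing.isZmodMorphism.Build R _ rho rhoB.
HB.instance Definition _ := GRing.isMonoidMorphism.Build R _ rho rhoM.

(** The image spans all matrices because every matrix is the matrix of an operator
    generated by R and F, by density. *)
Lemma spanning_rep :
  exists rho : {rmorphism R -> 'M[scalar]_n.+1},
    (forall A, exists w : seq (scalar * R), A = \sum_(p <- w) p.1 *: rho p.2) /\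
    forall r, rho r = 0 -> forall v : V, r *: v = 0.
Proof.
exists rho; split=> [A|r r0 v]; last first.
  by rewrite -(cooK v) -lc_rho [_ r]r0 mul0mx -(subrr 0) lcB subrr.
have [g Gg gs] := density_seq (fun u => lc (A *m coo u)) inds.
have [w gw] : exists w : seq (scalar * R), forall v, g v = \sum_(p <- w) p.1 (p.2 *: v).
  elim: Gg {gs} => [|f r h Ff _ [w hw]]; first by exists [::] => v; rewrite big_nil.
  by exists ((Scalar Ff, r) :: w) => v; rewrite big_cons hw.
exists w; apply: eq_rho => c.
transitivity (g (lc c)); last first.
  rewrite gw mulmx_suml lc_sum; apply: eq_bigr => p _.
  by rewrite -scalemxAl lcZ lc_rho.
have cE : c = \sum_j c j 0 *: coo (nth 0 s j).
  by apply: lc_inj; rewrite lc_sum; apply: eq_bigr => j _; rewrite lcZ cooK.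
rewrite {2}/lc (big_morph g (fun u v => operator_gD u v Gg) (operator_g0 Gg)).
rewrite {1}cE mulmx_sumr lc_sum; apply: eq_bigr => j _.
rewrite (operator_scal _ Gg (scalar_prop _)) gs ?mem_nth ?size_s //.
by rewrite -scalemxAr lcZ.
Qed.

End Coordinates.

Lemma matrix_representation (I : finType) n (a : seq I -> k) : #|I| = n ->
    ml_nonzero n a setT ->
    (forall (r : I -> R) v,
      mlact (fun c (v : V) => c%:A *: v) n a setT (fun j v => r j *: v) v = 0) ->
  exists (K : fieldType) (m : nat) (rho : {rmorphism R -> 'M[K]_m.+1}),
    (forall A, exists w : seq (K * R), A = \sum_(p <- w) p.1 *: rho p.2) /\
    forall r, rho r = 0 -> forall v : V, r *: v = 0.
Proof.
move=> In nz idR; have [s inds spans] := exists_basis In nz idR.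
case sz: (size s) => [|m].
  have [v /eqP[]] := V_neq0.
  by move: (spans v); rewrite (size0nil sz).
exists scalar, m; exact: (spanning_rep sz inds spans).
Qed.

End Density.

(** * A simple module on which a given element acts nontrivially *)

Section SimpleModule.
Variables (k : fieldType) (R : algType k).
Implicit Types p q : {poly R}.

Definition left_ideal (M : {poly R} -> Prop) : Prop :=
  (forall p q, M p -> M q -> M (p - q)) /\ (forall p q, M q -> M (p * q)).

Lemma exists_maximal_left_ideal g : (forall p, p * g != 1) ->
  exists M, [/\ left_ideal M, M g, ~ M 1 &
    forall p, ~ M p -> exists q, M (1 - q * p)].
Proof.
move=> g1.
(* The last condition lets the empty union of the empty chain be admissible. *)
pose proper (A : classical_sets.set {poly R}) :=
  [/\ left_ideal A, ~ A 1 & (exists p, A p) -> A g].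
have [|M [[[MB MM] M1 Mg] Mmax]] := @classical_sets.Zorn_bigcup _ proper.
  move=> C CP tot; split=> [|[A CA A1]|[p [A CA Ap]]].
  - split=> [p q [A CA Ap] [B CB Bq]|p q [A CA Aq]].
      have [AB|BA] := tot A B CA CB.
        by exists B => //; have [[BB _] _ _] := CP B CB; apply/BB/Bq/AB.
      by exists A => //; have [[AB _] _ _] := CP A CA; apply: AB => //; apply: BA.
    by exists A => //; have [[_ AM] _ _] := CP A CA; apply: AM.
  - by have [_ + _] := CP A CA; apply.
  - by exists A => //; have [_ _ +] := CP A CA; apply; exists p.
have {}Mg : M g.
  apply: Mg; apply: contrapT => M0; apply: (Mmax (fun p => exists q, p = q * g)).
    split=> [p Mp|gM]; first by case: M0; exists p.
    by apply: M0; exists g; apply: gM; exists 1; rewrite mul1r.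
  split=> [|[q /esym/eqP]|_].
  - split=> [_ _ [p ->] [q ->]|p _ [q ->]]; first by exists (p - q); rewrite mulrBl.
    by exists (p * q); rewrite mulrA.
  - by rewrite (negPf (g1 q)).
  - by exists 1; rewrite mul1r.
have M0 : M 0 by rewrite -(subrr g); apply: MB.
exists M; split=> // p nMp; apply: contrapT => np.
apply: (Mmax (fun u => exists q, M (u - q * p))).
  split=> [u Mu|pM]; first by exists 0; rewrite mul0r subr0.
  by apply/nMp/pM; exists 1; rewrite mul1r subrr.
split=> // [|_]; last by exists 0; rewrite mul0r subr0.
split=> [u v [q Mu] [r Mv]|u v [q Mv]].
  exists (q - r); have -> : u - v - (q - r) * p = (u - q * p) - (v - r * p).
    by rewrite mulrBl !opprD !opprK addrACA.
  exact: MB.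
by exists (u * q); rewrite -mulrA -mulrBr; apply: MM.
Qed.

(** An inverse would be the power series with coefficients c ^+ i. *)
Lemma polynomial_not_inverse (c : R) : (forall m, c ^+ m != 0) ->
  forall p, p * (1 - c%:P * 'X) != 1.
Proof.
move=> cn0 p; apply/eqP => p1.
have pc i : p`_i = c ^+ i.
  elim: i => [|i IHi].
    by have /(congr1 (fun q : {poly R} => q`_0)) := p1;
    rewrite mulrBr mulr1 coefB mulrA coefMX subr0 coef1.
  have /(congr1 (fun q : {poly R} => q`_i.+1)) := p1.
  rewrite mulrBr mulr1 coefB mulrA coefMX /= coefMC IHi coef1 => /eqP.
  by rewrite subr_eq0 => /eqP->; rewrite exprSr.
by have /eqP := cn0 (size p); rewrite -pc nth_default.
Qed.

Section Quotient.
Variable (M : {poly R} -> Prop).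
Hypotheses (idM : left_ideal M) (M1 : ~ M 1).
Hypothesis maxM : forall p, ~ M p -> exists q, M (1 - q * p).

Let M0 : M 0.
Proof.
apply: contrapT => /maxM[q]; rewrite mulr0 subr0 => /M1; exact.
Qed.

Definition in_ideal (p : {poly R}) := `[< M p >].

Let in_ideal_zmod : zmod_closed in_ideal.
Proof.
split=> [|p q /asboolP Mp /asboolP Mq]; apply/asboolP => //.
by case: idM => MB _; apply: MB.
Qed.


Let ideal_pred : zmodClosed {poly R} :=
  HB.pack in_ideal (GRing.isZmodClosed.Build _ in_ideal in_ideal_zmod).

Definition quo := Quotient.quot ideal_pred.
HB.instance Definition _ := GRing.Zmodule.on quo.

Let cls (p : {poly R}) : quo := \pi_(Quotient.quot ideal_pred)%qT p.

Let clsP p q : cls p = cls q <-> M (p - q).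
Proof.
split=> [/eqP|Mpq]; last first.
  by apply/eqP; rewrite /cls -Quotient.idealrBE; apply/asboolP.
by rewrite /cls -Quotient.idealrBE => /asboolP.
Qed.


Let clsB p q : cls (p - q) = cls p - cls q.
Proof. by rewrite /cls !piE. Qed.

Let cls_surj (u : quo) : exists p, u = cls p.
Proof. by exists (repr u); rewrite /cls reprK. Qed.

Let mulq p (u : quo) : quo := cls (p * repr (u : Quotient.quot ideal_pred)).

Let mulqE p q : mulq p (cls q) = cls (p * q).
Proof.
apply/clsP; rewrite -mulrBr; have [_ MM] := idM; apply: MM; apply/clsP.
by rewrite /cls reprK.
Qed.

Let clsD p q : cls (p + q) = cls p + cls q.
Proof. by rewrite /cls !piE. Qed.

Let cls0 : cls 0 = 0.
Proof. by rewrite -(subrr 0) clsB subrr. Qed.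

Let scaleA r s u : mulq r%:P (mulq s%:P u) = mulq (r * s)%:P u.
Proof. by have [p ->] := cls_surj u; rewrite !mulqE mulrA polyCM. Qed.
Let scale1 : left_id 1 (fun r => mulq r%:P).
Proof. by move=> u; have [p ->] := cls_surj u; rewrite !mulqE mul1r. Qed.
Let scaleDr : right_distributive (fun r => mulq r%:P) +%R.
Proof.
move=> r u v; have [p ->] := cls_surj u; have [q ->] := cls_surj v.
by rewrite -clsD !mulqE mulrDr clsD.
Qed.
Let scaleDl u : {morph (fun r => mulq r%:P u) : r s / r + s}.
Proof.
by move=> r s; have [p ->] := cls_surj u; rewrite !mulqE polyCD mulrDl clsD.
Qed.

HB.instance Definition _ := GRing.Zmodule_isLmodule.Build R quo
  scaleA scale1 scaleDr scaleDl.

(** If c annihilated the class of 1, then X c = c X would lie in M, and with it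
    the element 1. *)
Lemma simple_quotient c : M (1 - c%:P * 'X) ->
  exists (V : lmodType R) (z : V -> V), [/\ endo z z,
    forall W, invariant z W -> forall u, W u -> u != 0 -> forall v, W v &
    exists v : V, c *: v != 0].
Proof.
move=> Mc; exists quo, (mulq 'X); split.
- split=> [u v|r u|//].
    have [p ->] := cls_surj u; have [q ->] := cls_surj v.
    by rewrite -clsB !mulqE mulrBr clsB.
  have [p ->] := cls_surj u; rewrite -![_ *: _]/(mulq _ _) !mulqE.
  by rewrite !mulrA commr_polyX.
- move=> W [WB WZ Wz] u Wu u0.
  have W0 : W 0 by rewrite -(subrr u); apply: WB.
  have WD v w : W v -> W w -> W (v + w).
    by move=> Wv Ww; rewrite -[w]opprK -[- w]sub0r; apply/WB/(WB 0).
  have Wp p : W (mulq p u).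
    have [q uq] := cls_surj u; rewrite uq mulqE; rewrite uq in Wu.
    elim/poly_ind: p => [|p r IHp]; first by rewrite mul0r cls0.
    rewrite mulrDl clsD; apply: WD.
      by rewrite commr_polyX -mulrA -mulqE; apply: Wz.
    by rewrite -mulqE; apply: (WZ r).
  move=> v; have [p ->] := cls_surj v; have [q uq] := cls_surj u.
  have /maxM[r Mr] : ~ M q.
    move=> Mq; case/eqP: u0; rewrite uq -cls0.
    by apply/clsP; rewrite subr0.
  have -> : cls p = mulq (p * r) u; last exact: Wp.
  rewrite uq mulqE -mulrA; apply/clsP; rewrite -{1}[p]mulr1 -mulrBr.
  by have [_ MM] := idM; apply: MM.
- exists (cls 1); apply/eqP; rewrite -[_ *: _]/(mulq _ _) mulqE mulr1.
  rewrite -cls0.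
  move/clsP; rewrite subr0 => McP; apply: M1.
  have [MB MM] := idM.
  have -> : 1 = (1 - c%:P * 'X) - (0 - 'X * c%:P) by rewrite sub0r opprK commr_polyX subrK.
  by apply: (MB) => //; apply: (MB) => //; apply: MM.
Qed.

End Quotient.

(** Amitsur's trick: R itself may have no simple module on which c acts
    nontrivially, but after adjoining a central variable X the element c X can be
    made to fix a vector. *)
Lemma exists_simple_module (c : R) : (forall m, c ^+ m != 0) ->
  exists (V : lmodType R) (z : V -> V), [/\ endo z z,
    forall W, invariant z W -> forall u, W u -> u != 0 -> forall v, W v &
    exists v : V, c *: v != 0].
Proof.
move=> /polynomial_not_inverse /exists_maximal_left_ideal[M [idM Mg M1 maxM]].
exact: (simple_quotient idM M1 maxM Mg).
Qed.

End SimpleModule.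

(** * Representation of PI rings by matrices *)

Lemma mlact_module (k : fieldType) (R : algType k) (V : lmodType R) (I : finType)
    n a (D : {set I}) (r : I -> R) t (v : V) :
  mlact (fun c (v : V) => c%:A *: v) n a D (fun j v => r j *: v) (t *: v) =
    mlact *:%R n a D (fun j s => r j * s) t *: v.
Proof.
elim: n a D t => [|n IHn] a D t /=; first by rewrite scalerA mulr_algl.
by rewrite scaler_suml; apply: eq_bigr => j _; rewrite scalerA IHn.
Qed.

Lemma PI_matrix_representation (k : fieldType) (R : algType k) :
    satisfies_PI R -> noncommutative_modulo (@prime_radical R) ->
  exists (K : fieldType) (n : nat) (rho : {rmorphism R -> 'M[K]_n.+1}),
    (forall A, exists w : seq (K * R), A = \sum_(p <- w) p.1 *: rho p.2) /\
    exists r s, rho (r * s) != rho (s * r).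
Proof.
move=> /PI_multilinear[n [a [nz idR]]] ncomm.
have [r [s [P [prP nPrs]]]] : exists (r s : R) P,
    prime_ideal P /\ ~ P (r * s - s * r).
  apply: contrapT => h; apply: ncomm => r s P prP; apply: contrapT => nP.
  by apply: h; exists r, s, P.
set w := r * s - s * r in nPrs.
have [t wtn] : exists t, forall m, (w * t) ^+ m != 0.
  apply: contrapT => h; apply: nPrs.
  have cardn : #|[set: 'I_n]| = n by rewrite cardsT card_ord.
  apply: (nil_right_ideal_PI prP (T := fun u => exists t, u = w * t) cardn nz).
  - by move=> _ u [t ->]; exists (t * u); rewrite mulrA.
  - move=> _ [t ->]; apply: contrapT => nnil; apply: h; exists t => m.
    by apply/eqP => wt0; apply: nnil; exists m; rewrite wt0; case: prP => -[].
  - by move=> x u _ _; rewrite idR; case: prP => -[].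
  - by exists 1; rewrite mulr1.
have [V [z [zE Vs [v wtv]]]] := exists_simple_module wtn.
have [F Fmax] := exists_maximal_commuting z.
have V0 : exists v : V, v != 0 by exists (w * t *: v).
have [|K [m [rho [spanning rho0]]]] := matrix_representation zE Vs Fmax V0 (card_ord n) nz.
  by move=> x u; rewrite -[u]scale1r mlact_module idR scale0r.
exists K, m, rho; split=> //; exists r, s; rewrite -subr_eq0 -rmorphB.
by apply: contra_neq wtv => /rho0 w0; rewrite -scalerA w0.
Qed.

(** * Specialization to finite fields *)

Lemma finField_root (E : finFieldType) (p : {poly E}) : (1 < size p)%N ->
  exists (L : finFieldType) (j : {rmorphism E -> L}) (x : L), root (map_poly j p) x.
Proof.
move=> p1; have p0 : p != 0 by rewrite -size_poly_gt0 ltnW.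
have [L [zs Dp _]] := FinSplittingFieldFor p0.
exists (FinFieldExtType L), (in_alg L : {rmorphism E -> FinFieldExtType L}).
case: zs Dp => [|x zs] Dp.
  by have /eqp_size := Dp; rewrite big_nil size_map_poly size_poly1 => s1; rewrite s1 in p1.
by exists x; rewrite (eqp_root Dp) root_prod_XsubC mem_head.
Qed.

Lemma finField_nonroot (E : finFieldType) (p : {poly E}) : p != 0 ->
  exists (L : finFieldType) (j : {rmorphism E -> L}) (x : L), (map_poly j p).[x] != 0.
Proof.
(* A root of p X - 1 is not a root of p. *)
move=> p0; have sz : (1 < size (p * 'X - 1)%R)%N.
  by rewrite size_polyDl size_mulX // ?size_polyN ?size_poly1 ltnS size_poly_gt0.
have [L [j [x]]] := finField_root sz.
rewrite rmorphB rmorphM rmorph1 /= map_polyX rootE !hornerE subr_eq0 => /eqP px.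
by exists L, j, x; apply: contra_eq_neq px => ->; rewrite mul0r eq_sym oner_neq0.
Qed.

(** Adjoining a generator asks for finitely many elements of C, hence for their
    product d, to stay nonzero; this is why the induction carries d. *)
Definition specializable (F : fieldType) (C : idomainType) (iota : {rmorphism C -> F}) :=
  forall d, iota d != 0 ->
  exists (E : finFieldType) (phi : {rmorphism C -> E}),
    phi d != 0 /\ forall c, iota c = 0 -> phi c = 0.

(** Reduce modulo the characteristic of F, or modulo a prime larger than |d|. *)
Lemma specializable_int (F : fieldType) : specializable (intr : {rmorphism int -> F}).
Proof.
move=> d d0.
have zero_char (G : fieldType) (c : int) : (c%:~R == 0 :> G) = (`|c|%N%:R == 0 :> G).
  by case: c => n //; rewrite NegzE mulrNz oppr_eq0.
have [[p pF]|noF] := pselect (exists p, p \in [pchar F]).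
  have pE := pchar_Fp (pcharf_prime pF).
  have same c : (c%:~R == 0 :> 'F_p) = (c%:~R == 0 :> F).
    by rewrite !zero_char -(dvdn_pcharf pE) -(dvdn_pcharf pF).
  exists 'F_p, (intr : {rmorphism int -> 'F_p}); split; first by rewrite same.
  by move=> c /eqP; rewrite -same => /eqP.
have F0 n : (n%:R == 0 :> F) = (n == 0)%N.
  have [F0 _] := pcharf0P F; apply: F0 => p.
  by apply/negbTE/negP => pF; apply: noF; exists p.
have [p dp pp] := prime_above `|d|.
exists 'F_p, (intr : {rmorphism int -> 'F_p}); split; last first.
  by move=> c /eqP; rewrite /= zero_char F0 absz_eq0 => /eqP->.
rewrite /= zero_char F0 in d0 *; rewrite zero_char -(dvdn_pcharf (pchar_Fp pp)).
by rewrite gtnNdvd // lt0n.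
Qed.

Section Adjunction.
Variables (F : fieldType) (C : idomainType) (iota : {rmorphism C -> F}) (x : F).

Definition adjunction : {rmorphism {poly C} -> F} :=
  horner_morph (fun c => mulrC x (iota c)).

Lemma adjunctionE p : adjunction p = (map_poly iota p).[x].
Proof. by []. Qed.

Lemma adjunctionC c : adjunction c%:P = iota c.
Proof. by rewrite adjunctionE map_polyC hornerC. Qed.

End Adjunction.

Lemma adjunction_comp (C : idomainType) (E L : finFieldType) (phi : {rmorphism C -> E})
    (j : {rmorphism E -> L}) (y : L) p :
  adjunction (j \o phi) y p = (map_poly j (map_poly phi p)).[y].
Proof.
by rewrite adjunctionE; congr _.[_]; apply/polyP => i; rewrite !coef_map.
Qed.

Section AdjunctionSpecialization.
Variables (F : fieldType) (C : idomainType) (iota : {rmorphism C -> F}) (x : F).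
Hypothesis spec : specializable iota.
Local Notation ad := (adjunction iota x).


Let drop_lead (g : {poly C}) : g != 0 -> iota (lead_coef g) = 0 ->
  exists2 g' : {poly C}, (size g' < size g)%N & map_poly iota g' = map_poly iota g.
Proof.
move=> g0 lg0; exists (\poly_(i < (size g).-1) g`_i).
  by rewrite (leq_ltn_trans (size_poly _ _)) // prednK // size_poly_gt0.
apply/polyP => i; rewrite !coef_map coef_poly; case: ltngtP => // [gi|->].
  by rewrite nth_default // -(prednK (n := size g)) // size_poly_gt0.
exact: (etrans (rmorph0 iota) (esym lg0)).
Qed.

Let pseudo_division (p q : {poly C}) : q != 0 ->
  exists (m : nat) (u r : {poly C}),
    (lead_coef q ^+ m)%:P * p = u * q + r /\ (size r < size q)%N.
Proof.
move=> q0; exists (scalp p q), (p %/ q), (p %% q).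
by rewrite mul_polyC Pdiv.Idomain.divp_eq Pdiv.Idomain.ltn_modp.
Qed.

Let map_poly_ker (K : fieldType) (psi : {rmorphism C -> K}) (g : {poly C}) :
  (forall c, iota c = 0 -> psi c = 0) -> map_poly iota g = 0 -> map_poly psi g = 0.
Proof.
move=> kerpsi g0; apply/polyP => i; rewrite coef_map coef0; apply: kerpsi.
by rewrite -coef_map g0 coef0.
Qed.

(* A coefficient of d must be kept nonzero; then any value of x at which d does
   not vanish will do. *)
Let specialize_transcendental :
  (forall g, ad g = 0 -> map_poly iota g = 0) -> specializable ad.
Proof.
move=> transc d d0.
have [i di] : exists i, iota d`_i != 0.
  apply: contrapT => h; case/eqP: d0; rewrite adjunctionE -[RHS](horner0 x); congr _.[_].
  apply/polyP => i; rewrite coef_map coef0; apply: contrapT => /eqP di.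
  by apply: h; exists i.
have [E [phi [phid kerphi]]] := spec di.
have [|L [j [y dy]]] := @finField_nonroot _ (map_poly phi d).
  by apply: contra_neq phid => /polyP/(_ i); rewrite coef_map coef0.
exists L, (adjunction (j \o phi) y); split=> [|g /transc g0].
  by rewrite adjunction_comp.
rewrite adjunctionE (map_poly_ker _ g0) ?horner0 // => c /kerphi /= ->.
exact: rmorph0.
Qed.

Let bar_eq_ad (g h : {poly C}) : map_poly iota g = map_poly iota h -> ad g = ad h.
Proof. by rewrite !adjunctionE => ->. Qed.

Let adC c : ad c%:P = iota c.
Proof. exact: adjunctionC. Qed.

(* Some nonzero multiple of d(x) lies in the image of C. Take u of least size
   such that u(x) is a nonzero multiple of d(x). If u is not constant, then
   pseudo-division, of u by f or of f by u, yields either a smaller such u, or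
   a quotient which vanishes at x and is smaller than f, against the minimality
   of f. *)
Let algebraic_multiple f d :
    ad f = 0 -> map_poly iota f != 0 ->
    (forall g, ad g = 0 -> (size g < size f)%N -> map_poly iota g = 0) ->
    ad d != 0 ->
  exists c a, iota c != 0 /\ ad (c%:P - a * d) = 0.
Proof.
move=> f0 nf0 fmin d0.
pose A n := `[< exists u a : {poly C}, [/\ size u = n, ad u != 0 & ad (u - a * d) = 0] >].
have exA : exists n, A n.
  by exists (size d); apply/asboolP; exists d, 1; rewrite mul1r subrr rmorph0.
case: (ex_minnP exA) => n /asboolP[u [a [un nu0 ua]]] nmin.
have umin v b : ad v != 0 -> ad (v - b * d) = 0 -> (size u <= size v)%N.
  by move=> v0 vb; rewrite un; apply: nmin; apply/asboolP; exists v, b.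
have u0 : u != 0 by apply: contra_neq nu0 => ->; apply: rmorph0.
have lu : iota (lead_coef u) != 0.
  apply/eqP => /(drop_lead u0)[v vu /bar_eq_ad uv].
  have := umin v a; rewrite rmorphB uv -rmorphB => /(_ nu0 ua).
  by rewrite leqNgt vu.
have [|u1] := leqP (size u) 1.
  move=> /size1_polyC uE; exists u`_0, a; rewrite -uE; split=> //.
  by rewrite -adC -uE.
have {ua} uaE : ad u = ad a * ad d by apply/eqP; rewrite -rmorphM -subr_eq0 -rmorphB ua.
have f_neq0 : f != 0 by apply: contra_neq nf0 => ->; rewrite rmorph0.
have lf : iota (lead_coef f) != 0.
  apply/eqP => /(drop_lead f_neq0)[v vf vfE].
  by move/bar_eq_ad: (vfE); rewrite f0 => /fmin/(_ vf)/eqP; rewrite vfE (negPf nf0).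
have [fu|uf] := ltnP (size f) (size u).
  have [m [q [r [E sr]]]] := pseudo_division u f_neq0.
  have Er : ad r = iota (lead_coef f) ^+ m * ad u.
    by rewrite -rmorphXn -adC -rmorphM E rmorphD rmorphM f0 mulr0 add0r.
  have nr0 : ad r != 0 by rewrite Er mulf_neq0 ?expf_neq0.
  have := umin r ((lead_coef f ^+ m)%:P * a) nr0.
  rewrite rmorphB !rmorphM adC rmorphXn Er uaE mulrA subrr => /(_ erefl).
  by rewrite leqNgt (ltn_trans sr).
have [m [q [r [E sr]]]] := pseudo_division f u0.
have r0 : ad r = 0.
  apply/eqP; apply: contraTT sr => nr0; rewrite -leqNgt.
  apply: (umin r (- (q * a)) nr0); rewrite mulNr opprK -mulrA.
  have := congr1 ad E; rewrite !rmorphD !rmorphM f0 mulr0 uaE addrC => /esym.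
  by [].
have q0 : ad q = 0.
  have := congr1 ad E; rewrite !(rmorphD, rmorphM) f0 r0 mulr0 addr0 => /esym/eqP.
  by rewrite mulf_eq0 (negPf nu0) orbF => /eqP.
have bq0 : map_poly iota q = 0.
  have [->|q_neq0] := eqVneq q 0; first exact: rmorph0.
  apply: (fmin) => //.
  have : (size (q * u)%R <= size f)%N.
    have -> : q * u = (lead_coef u ^+ m)%:P * f - r by rewrite E addrK.
    rewrite (leq_trans (size_polyD _ _)) // size_polyN geq_max (leq_trans (ltnW sr)) ?andbT //.
    by rewrite mul_polyC size_scale_leq.
  rewrite size_mul // => h; apply: leq_trans h; case: (size u) u1 => [|[|l]] // _.
  by rewrite !addnS ltnS leq_addr.
have br0 : map_poly iota r = 0 by apply: fmin => //; apply: leq_trans uf.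
have := congr1 (map_poly iota) E.
rewrite rmorphD !rmorphM /= bq0 br0 mul0r add0r map_polyC => /eqP.
have lum : iota (lead_coef u ^+ m) != 0 by rewrite rmorphXn expf_neq0.
by rewrite mulf_eq0 (negPf nf0) orbF polyC_eq0 => lum0; case/negP: lum.
Qed.

(* With f of least size among the relations of x: keep the leading coefficient
   of f and the constant c = a(x) d(x) nonzero, and send x to a root of the
   image of f. By pseudo-division by f, all relations of x are preserved, so the
   image of d divides that of c. *)
Let specialize_algebraic f0 :
  ad f0 = 0 -> map_poly iota f0 != 0 -> specializable ad.
Proof.
move=> f00 nf00 d d0.
pose A n := `[< exists g : {poly C}, [/\ size g = n, ad g = 0 & map_poly iota g != 0] >].
have exA : exists n, A n by exists (size f0); apply/asboolP; exists f0.
case: (ex_minnP exA) => n /asboolP[f [fn f_0 nf0]] nmin.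
have fmin g : ad g = 0 -> (size g < size f)%N -> map_poly iota g = 0.
  move=> g0 gf; apply/eqP; apply: contraTT gf => ng0; rewrite -leqNgt fn.
  by apply: nmin; apply/asboolP; exists g.
have [c [a [c0 ca]]] := algebraic_multiple f_0 nf0 fmin d0.
have f_neq0 : f != 0 by apply: contra_neq nf0 => ->; rewrite rmorph0.
have lf : iota (lead_coef f) != 0.
  apply/eqP => /(drop_lead f_neq0)[v vf vfE].
  by move/bar_eq_ad: (vfE); rewrite f_0 => /fmin/(_ vf)/eqP; rewrite vfE (negPf nf0).
have [|E [phi [phi0 kerphi]]] := spec (d := lead_coef f * c).
  by rewrite rmorphM mulf_neq0.
have [phil phic] : phi (lead_coef f) != 0 /\ phi c != 0.
  by move: phi0; rewrite rmorphM mulf_eq0 negb_or => /andP[].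
have [|L [j [y fy]]] := @finField_root _ (map_poly phi f).
  rewrite size_map_poly_id0 //.
  rewrite ltnNge; apply: contra_neqN nf0 => /size1_polyC fE.
  by move: f_0; rewrite fE adjunctionC map_polyC => /= ->.
pose psi := adjunction (j \o phi) y.
have psi_ker g : ad g = 0 -> psi g = 0.
  move=> g0; have [m [q [r [Eg sr]]]] := pseudo_division g f_neq0.
  have r0 : map_poly iota r = 0.
    apply: fmin sr; have := congr1 ad Eg.
    by rewrite !(rmorphD, rmorphM) f_0 g0 !mulr0 add0r.
  have psir : psi r = 0.
    rewrite /psi adjunctionE (map_poly_ker _ r0) ?horner0 // => b /kerphi /= ->.
    exact: rmorph0.
  have psif : psi f = 0.
    by apply/eqP; rewrite /psi adjunction_comp.
  have := congr1 psi Eg; rewrite !(rmorphD, rmorphM) psir psif mulr0 addr0 => /eqP.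
  rewrite mulf_eq0 => /orP[|/eqP//].
  by rewrite /psi adjunctionC /= !rmorphXn expf_eq0 fmorph_eq0 (negPf phil) andbF.
exists L, psi; split=> //; have /psi_ker := ca.
rewrite rmorphB rmorphM /= => /eqP; rewrite subr_eq0 /psi adjunctionC => /eqP h.
apply: contraNneq phic => psid; move: h; rewrite psid mulr0 => /eqP.
by rewrite fmorph_eq0.
Qed.

Lemma specializable_adjunction : specializable ad.
Proof.
have [transc|] := pselect (forall g, ad g = 0 -> map_poly iota g = 0).
  exact: specialize_transcendental.
move=> h; have [f [f0 nf0]] : exists f, ad f = 0 /\ map_poly iota f != 0.
  apply: contrapT => nf; apply: h => g g0; apply: contrapT => /eqP ng0.
  by apply: nf; exists g.
exact: specialize_algebraic f0 nf0.
Qed.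
End AdjunctionSpecialization.

Theorem finite_specialization (F : fieldType) (xs : seq F) :
  exists (C : idomainType) (iota : {rmorphism C -> F}) (E : finFieldType)
      (phi : {rmorphism C -> E}),
    (forall x, x \in xs -> exists c, iota c = x) /\
    forall c, iota c = 0 -> phi c = 0.
Proof.
suff [C [iota [spec surj]]] : exists (C : idomainType) (iota : {rmorphism C -> F}),
    specializable iota /\ forall x, x \in xs -> exists c, iota c = x.
  have [|E [phi [_ kerphi]]] := spec 1; first by rewrite rmorph1 oner_neq0.
  by exists C, iota, E, phi.
elim: xs => [|x xs [C [iota [spec surj]]]].
  by exists int, intr; split=> //; apply: specializable_int.
exists {poly C}, (adjunction iota x); split; first exact: specializable_adjunction.
move=> y; rewrite inE => /predU1P[->|/surj[c <-]].
  by exists 'X; rewrite adjunctionE map_polyX hornerX.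
by exists c%:P; apply: adjunctionC.
Qed.

(** * Ping-pong in a finite ring of matrices *)

(** [S_span] states, as an induction principle, that S spans all matrices over
    E. *)
Section FiniteMatrixRing.
Variables (E : finFieldType) (n : nat) (S : 'M[E]_n.+2 -> Prop).
Hypotheses (S1 : S 1) (SB : forall A B, S A -> S B -> S (A - B))
  (SM : forall A B, S A -> S B -> S (A * B)).
Hypothesis S_span : forall Q : 'M[E]_n.+2 -> Prop,
  (forall a A B, Q A -> Q B -> Q (a *: A + B)) -> Q 0 ->
  (forall A, S A -> Q A) -> forall A, Q A.

Let S0 : S 0. Proof. by rewrite -(subrr 1); apply: SB. Qed.
Let SD A B : S A -> S B -> S (A + B).
Proof. by move=> SA SBB; rewrite -[B]opprK -[- B]sub0r; apply/SB/SB. Qed.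

Section Division.
Hypothesis S_unit : forall A, S A -> A != 0 -> A \is a GRing.unit.

Let Sb (A : 'M[E]_n.+2) := `[< S A >].

(* Multiplication by A is an injection of the finite set S into itself. *)
Let S_inv A : S A -> S A^-1.
Proof.
have [->|A0] := eqVneq A 0; first by rewrite invr0.
move=> SA; have uA := S_unit SA A0.
pose U : {set 'M[E]_n.+2} := [set B | Sb B].
have AU : [set A * B | B in U] = U.
  apply/eqP; rewrite eqEcard card_imset ?leqnn ?andbT; last exact: mulrI.
  apply/subsetP => _ /imsetP[B + ->]; rewrite !inE => /asboolP SBB.
  by apply/asboolP/SM.
have : 1 \in U by rewrite inE; apply/asboolP.
rewrite -AU => /imsetP[B]; rewrite inE => /asboolP SBB AB.
by rewrite -(mulKr uA B) -AB mulr1 in SBB.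
Qed.

Let Sb_divring : divring_closed Sb.
Proof.
split=> [|A B /asboolP SA /asboolP SBB|A B /asboolP SA /asboolP SBB]; apply/asboolP => //.
  exact: SB.
by apply: SM => //; apply: S_inv.
Qed.

Let Spred : divringClosed 'M[E]_n.+2 :=
  HB.pack Sb (GRing.isDivringClosed.Build _ Sb Sb_divring).

Definition Stype := {A : 'M[E]_n.+2 | A \in Spred}.
HB.instance Definition _ := Finite.on Stype.
HB.instance Definition _ := SubChoice.on Stype.
HB.instance Definition _ := [SubChoice_isSubUnitRing of Stype by <:].

(** Wedderburn's little theorem. *)
Lemma finite_division_commutes A B : S A -> S B -> A * B = B * A.
Proof.
move=> SA SBB.
have dom : GRing.MathCompCompatIntegralDomain.IntegralDomain.axiom Stype.
  move=> x y xy0; apply/orP.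
  have valxy : sval x * sval y = 0 by have := congr1 val xy0.
  have [x0|x0] := eqVneq (sval x) 0; first by left; apply/eqP/val_inj.
  have Sx : S (sval x) by have /asboolP := valP x.
  have ux : sval x \is a GRing.unit by apply: S_unit.
  by right; apply/eqP/val_inj; rewrite /= -(mulKr ux (sval y)) valxy mulr0.
have SA' : A \in Spred by apply/asboolP.
have SB' : B \in Spred by apply/asboolP.
have := finDomain_mulrC dom (exist _ A SA') (exist _ B SB').
by move/(congr1 val).
Qed.
End Division.

(** Otherwise S is a finite division ring, hence commutative, and so are all
    matrices over E, which S spans. *)
Lemma exists_singular : exists A, [/\ S A, A != 0 & (\rank A < n.+2)%N].
Proof.
apply: contrapT => h.
have S_unit A : S A -> A != 0 -> A \is a GRing.unit.
  move=> SA A0; rewrite -row_full_unit /row_full eqn_leq rank_leq_col leqNgt.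
  by apply/negP => rA; apply: h; exists A.
have comm (A B : 'M[E]_n.+2) : A * B = B * A.
  apply: (@S_span (fun A => A * B = B * A)) => [a A1 A2 h1 h2||{}A SA].
  - by rewrite mulrDl mulrDr -scalerAl -scalerAr h1 h2.
  - by rewrite mul0r mulr0.
  apply: (@S_span (fun B => A * B = B * A)) => [a A1 A2 h1 h2||{}B SB'].
  - by rewrite mulrDl mulrDr -scalerAl -scalerAr h1 h2.
  - by rewrite mul0r mulr0.
  exact: finite_division_commutes.
have := comm (delta_mx 0 1) (delta_mx 1 0); rewrite -!mulmxE !mul_delta_mx.
by move/matrixP/(_ 0 0)/eqP; rewrite !mxE /= oner_eq0.
Qed.

(** Among elements of the least nonzero rank r, a nonzero product A B has rank r,
    hence the row space of B. As S spans all matrices, some e = s e0 of rank r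
    satisfies e e != 0, and some f = e g has another row space: otherwise the row
    space of e would be invariant under all matrices. Replacing g by g + 1 if
    needed, e g e != 0, which makes all four products nonzero. *)
Lemma ping_pong_pair : exists e f, [/\ S e, S f, ~~ (f <= e)%MS,
    (\rank e < n.+2)%N & \rank f = \rank e] /\
  forall x y, x \in [:: e; f] -> y \in [:: e; f] -> \rank (x * y)%R = \rank e.
Proof.
pose P r := `[< exists A, [/\ S A, A != 0 & \rank A = r] >].
have [A0 [SA0 A0n0 rA0]] := exists_singular.
have exP : exists r, P r by exists (\rank A0); apply/asboolP; exists A0.
case: (ex_minnP exP) => r /asboolP[e0 [Se0 e0n0 re0]] rmin.
have r_lt : (r < n.+2)%N.
  by apply: leq_ltn_trans rA0; apply: rmin; apply/asboolP; exists A0.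
have rankM A B : S A -> S B -> A * B != 0 -> \rank B = r ->
    \rank (A * B)%R = r /\ ((A * B)%R :=: B)%MS.
  move=> SA SB' AB0 rB.
  have rAB : \rank (A * B)%R = r.
    apply/eqP; rewrite eqn_leq -{1}rB mxrankS ?submxMl //=.
    by apply: rmin; apply/asboolP; exists (A * B); split=> //; apply: SM.
  split=> //; apply/eqmxP; rewrite submxMl /=.
  by rewrite -(geq_leqif (mxrank_leqif_sup (submxMl A B))) rB [\rank _]rAB.
have [s [Ss ese]] : exists s, S s /\ e0 * s * e0 != 0.
  apply: contrapT => h; case/eqP: e0n0; apply/matrixP => i j; rewrite mxE.
  have all0 : forall A, e0 * A * e0 = 0.
    apply: S_span => [a A B h1 h2||A SA]; first 1 last.
    - by rewrite mulr0 mul0r.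
    - by apply: contrapT => /eqP hA; apply: h; exists A.
    by rewrite mulrDr mulrDl -scalerAr -scalerAl h1 h2 scaler0 addr0.
  have /matrixP/(_ i j)/eqP := all0 (delta_mx j i).
  rewrite -!mulmxE mxE (bigD1 i) //= big1 => [|l li]; last first.
    rewrite mxE big1 ?mul0r // => m _.
    by rewrite mxE (negPf li) andbF mulr0.
  rewrite mxE (bigD1 j) //= big1 => [|l lj]; last by rewrite mxE (negPf lj) mulr0.
  by rewrite !mxE !eqxx /= mulr1 !addr0 mulf_eq0 orbb => /eqP.
pose e := s * e0.
have Se : S e by apply: SM.
have e0e : e0 * e != 0 by rewrite mulrA.
have [re eE] : \rank e = r /\ (e :=: e0)%MS.
  by apply: rankM => //; apply: contraNneq e0e => ee0; rewrite /e ee0 mulr0.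
have ree : \rank (e * e)%R = r.
  by rewrite [LHS](eqmxMr e eE); have [] := rankM e0 e Se0 Se e0e re.
have nz A : \rank A = r -> A != 0 :> 'M[E]_n.+2.
  move=> rA; rewrite -mxrank_eq0 rA -re; apply: contraNneq e0e.
  by move=> /eqP; rewrite mxrank_eq0 => /eqP->; rewrite mulr0.
clearbody e.
have [g0 [Sg0 ng0]] : exists g, S g /\ ~~ ((e * g)%R <= e)%MS.
  apply: contrapT => h.
  have all_e : forall A, ((e * A)%R <= e)%MS.
    apply: S_span => [a A B h1 h2||A SA].
    - by rewrite mulrDr -scalerAr addmx_sub ?scalemx_sub.
    - by rewrite mulr0 sub0mx.
    - by apply: contrapT => /negP hA; apply: h; exists A.
  have [i [j eij]] : exists i j, e i j != 0.
    apply: contrapT => e0'; case/eqP: (nz _ re); apply/matrixP => i j; rewrite mxE.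
    by apply: contrapT => /eqP eij; apply: e0'; exists i, j.
  have : (1%:M <= e)%MS.
    apply/row_subP => l; rewrite row1.
    have -> : delta_mx 0 l = (e i j)^-1 *: row i (e * delta_mx j l) :> 'rV_n.+2.
      apply/rowP => m; rewrite -mulmxE !mxE (bigD1 j) //= big1 => [|l1 hj].
        by rewrite mxE eqxx addr0 mulrA mulVf // mul1r.
      by rewrite mxE (negPf hj) mulr0.
    exact: scalemx_sub (submx_trans (row_sub _ _) (all_e _)).
  by rewrite sub1mx /row_full re => /eqP rn; rewrite rn ltnn in r_lt.
have [g [Sg ng rege]] : exists g, [/\ S g, ~~ ((e * g)%R <= e)%MS & \rank (e * g * e)%R = r].
  have [ege0|ege0] := eqVneq (e * g0 * e) 0; last first.
    by exists g0; split=> //; have [] := rankM _ _ (SM Se Sg0) Se ege0 re.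
  exists (g0 + 1); split; first exact: SD.
    apply: contra ng0; rewrite mulrDr mulr1 => h.
    by rewrite -(addrK e (e * g0)) addmx_sub // eqmx_opp.
  by rewrite mulrDr mulr1 mulrDl ege0 add0r.
have Sf : S (e * g) by apply: SM.
have rf : \rank (e * g)%R = r.
  apply/eqP; rewrite eqn_leq -{1}re mxrankM_maxl /=; apply: rmin; apply/asboolP.
  exists (e * g); split=> //; apply: contraTneq (nz _ rege) => ->.
  by rewrite mul0r eqxx.
exists e, (e * g); split; first by split; rewrite ?re.
move=> x y; rewrite re.
have [_ eeE] := rankM e e Se Se (nz _ ree) re.
have [_ egeE] := rankM _ e Sf Se (nz _ rege) re.
rewrite !inE => /pred2P[->|->] /pred2P[->|->] //.
  by rewrite mulrA [LHS](eqmxMr g eeE).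
by rewrite mulrA [LHS](eqmxMr g egeE).
Qed.
End FiniteMatrixRing.

(** * Free pairs *)

Lemma exists_nontorsion (k : fieldType) : ~ algebraic_over_finite_subfield k ->
  exists t : k, forall i j, t ^+ i = t ^+ j -> i = j.
Proof.
move=> nalg; have [[p pk]|nopk] := pselect (exists p, p \in [pchar k]).
  apply: contrapT => tors; apply: nalg.
  have [phi _] : exists phi : {rmorphism 'F_p -> k}, True.
    pose phi : {rmorphism 'F_p -> pPrimeCharType pk} := in_alg (pPrimeCharType pk).
    by exists phi.
  exists 'F_p, phi => x.
  have [i [j [ij xij]]] : exists i j, i != j /\ x ^+ i = x ^+ j.
    apply: contrapT => h; apply: tors; exists x => i j xij; apply: contrapT => /eqP ij.
    by apply: h; exists i, j.
  exists ('X^i - 'X^j).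
    apply/eqP => /polyP/(_ i)/eqP.
    by rewrite coefB !coefXn eqxx (negPf ij) subr0 coef0 oner_eq0.
  by rewrite rmorphB /= !map_polyXn rootE !hornerE xij subrr.
have k0 n : (n%:R == 0 :> k) = (n == 0)%N.
  have [H _] := pcharf0P k; apply: H => p.
  by apply/negbTE/negP => pk; apply: nopk; exists p.
exists 2%:R.
suff le i j : (i <= j)%N -> 2%:R ^+ i = 2%:R ^+ j :> k -> i = j.
  by move=> i j e; have [/le|/ltnW/le h] := leqP i j; [apply | apply/esym/h/esym].
move=> ij; rewrite -!natrX => /eqP; rewrite eq_sym -subr_eq0 -natrB ?leq_pexp2l //.
rewrite k0 subn_eq0 leq_exp2l // => ji; apply/eqP; by rewrite eqn_leq ij.
Qed.

Lemma central_matrix_scalar (K : fieldType) n (A : 'M[K]_n.+1) :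
  (forall B, A *m B = B *m A) -> exists a, A = a%:M.
Proof.
move=> comm; exists (A 0 0); apply/matrixP => i j; rewrite !mxE.
have /matrixP/(_ i 0) := comm (delta_mx j 0).
rewrite !mxE (bigD1 j) //= big1 => [|l lj]; last by rewrite mxE (negPf lj) mulr0.
rewrite mxE !eqxx mulr1 addr0 => ->.
rewrite (bigD1 0) //= big1 => [|l l0]; last by rewrite mxE (negPf l0) andbF mul0r.
by rewrite mxE eqxx andbT addr0 mulr_natl.
Qed.

(** Only finitely many scalars are roots of the characteristic polynomial. *)
Lemma exists_unit_shift (K : fieldType) n (A : 'M[K]_n.+1) (c : nat -> K) :
  injective c -> exists j, A + (c j)%:M \is a GRing.unit.
Proof.
move=> c_inj; apply: contrapT => sing; set p := char_poly (- A).
have rootp j : root p (c j).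
  rewrite -eigenvalue_root_char /eigenvalue /eigenspace kermx_eq0 row_free_unit.
  apply/negP => uj; apply: sing; exists j.
  by rewrite -unitrN opprD.
have := @max_poly_roots _ p [seq c j | j <- iota 0 (size p)].
rewrite size_map size_iota ltnn map_inj_uniq // iota_uniq => /(_ _ _ isT) h.
suff : false by []; apply: h; first exact/monic_neq0/char_poly_monic.
by apply/allP => _ /mapP[j _ ->].
Qed.

(** The letters act on row vectors from the right, so the last letter of a word
    determines its row space. *)
Section PingPong.
Variables (E : fieldType) (n : nat) (g : bool -> 'M[E]_n.+2) (r : nat).
Hypotheses (rank_g : forall b, \rank (g b) = r) (r_lt : (r < n.+2)%N).
Hypothesis rank_gg : forall b c, \rank (g b * g c)%R = r.
Hypothesis g_neq : ~~ (g false <= g true)%MS.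

Lemma ping_pong_word w b : (\prod_(i <- rcons w b) g i :=: g b)%MS.
Proof.
have eqg c d : ((g c * g d)%R :=: g d)%MS.
  apply/eqmxP; rewrite submxMl /=.
  by rewrite -(geq_leqif (mxrank_leqif_sup (submxMl (g c) (g d)))) [\rank (_ *m _)]rank_gg rank_g.
elim/last_ind: w b => [|w c IHw] b; first by rewrite big_seq1.
rewrite -cats1 big_cat big_seq1 /=.
exact: eqmx_trans (eqmxMr (g b) (IHw c)) (eqg c b).
Qed.

(** A nonempty word in g is singular, so it is not 1, and two words with different
    last letters have different row spaces; equal last letters are cancelled
    among the units h. *)
Lemma ping_pong_free (T : unitRingType) (h : bool -> T) :
    (forall b, h b \is a GRing.unit) ->
    (forall u v, \prod_(i <- u) h i = \prod_(i <- v) h i ->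
      \prod_(i <- u) g i = \prod_(i <- v) g i) ->
  forall u v : seq bool, \prod_(i <- u) h i = \prod_(i <- v) h i -> u = v.
Proof.
move=> hU hg.
have eq_last u v b c :
    \prod_(i <- rcons u b) h i = \prod_(i <- rcons v c) h i -> (g b <= g c)%MS.
  move/hg => uv; rewrite -(ping_pong_word u b) uv.
  by rewrite (ping_pong_word v c).
have nontriv u b : \prod_(i <- rcons u b) h i <> 1.
  move=> ub1; have := hg (rcons u b) [::]; rewrite big_nil => /(_ ub1) /(congr1 mxrank).
  rewrite big_nil (ping_pong_word u b) rank_g mxrank1 => rn.
  by move: r_lt; rewrite rn ltnn.
elim/last_ind => [|u b IHu] v; case/lastP: v => [//|v c].
- by rewrite big_nil => /esym /nontriv.
- by rewrite big_nil => /nontriv.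
move=> uv; have bc : b = c.
  have gbc := eq_last _ _ _ _ uv; have gcb := eq_last _ _ _ _ (esym uv).
  by case: b c gbc gcb {uv} => [] [] //; rewrite (negPf g_neq).
rewrite bc in uv *; congr rcons; apply: IHu.
by move: uv; rewrite -!cats1 !big_cat !big_seq1 => /(mulIr (hU c)).
Qed.
End PingPong.

Section FreePair.
Variables (k : fieldType) (R : algType k) (K : fieldType) (n : nat).
Variable rho : {rmorphism R -> 'M[K]_n.+2}.
Hypothesis spanning : forall A : 'M[K]_n.+2,
  exists w : seq (K * R), A = \sum_(p <- w) p.1 *: rho p.2.
Variables (t : k) (tau : K).
Hypotheses (t_nontorsion : forall i j, t ^+ i = t ^+ j -> i = j)
  (rho_t : rho t%:A = tau%:M).

Lemma rho_tX l : rho (t ^+ l)%:A = (tau ^+ l)%:M.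
Proof.
elim: l => [|l IHl]; first by rewrite !expr0 scale1r rmorph1.
have -> : (t ^+ l.+1)%:A = t%:A * (t ^+ l)%:A :> R.
  by rewrite mulr_algl scalerA exprS.
by rewrite rmorphM rho_t IHl exprS scalar_mxM.
Qed.

Lemma tau_nontorsion i j : tau ^+ i = tau ^+ j -> i = j.
Proof.
move=> tij; apply: t_nontorsion; apply/eqP; rewrite -subr_eq0; apply/negPn/negP => c0.
have : rho ((t ^+ i - t ^+ j)^-1%:A * (t ^+ i - t ^+ j)%:A) = 0.
  by rewrite rmorphM scalerBl rmorphB !rho_tX tij subrr mulr0.
by rewrite mulr_algl scalerA mulVf // scale1r rmorph1 => /eqP; rewrite oner_eq0.
Qed.

(** [w] expresses the matrix units through rho(R); [L] lifts to C the finitely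
    many elements of K that occur. *)
Section Specialization.
Variables (C : idomainType) (E : finFieldType).
Variables (iota : {rmorphism C -> K}) (phi : {rmorphism C -> E}).
Hypothesis ker_phi : forall c, iota c = 0 -> phi c = 0.
Variables (L : K -> C) (w : 'I_n.+2 -> 'I_n.+2 -> seq (K * R)).
Hypotheses (w_delta : forall i j, delta_mx i j = \sum_(p <- w i j) p.1 *: rho p.2)
  (L_tau : iota (L tau) = tau)
  (L_coef : forall i j p, p \in w i j -> iota (L p.1) = p.1)
  (L_entry : forall i j p, p \in w i j ->
    forall a b, iota (L (rho p.2 a b)) = rho p.2 a b).

Let mxi (A : 'M[C]_n.+2) : 'M[K]_n.+2 := map_mx iota A.
Let mxp (A : 'M[C]_n.+2) : 'M[E]_n.+2 := map_mx phi A.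

Lemma map_mx_ker A B : mxi A = mxi B -> mxp A = mxp B.
Proof.
move=> AB; apply/matrixP => i j; rewrite !mxE; apply/eqP.
rewrite -subr_eq0 -rmorphB ker_phi // rmorphB; apply/eqP; rewrite subr_eq0; apply/eqP.
by have /matrixP/(_ i j) := AB; rewrite !mxE.
Qed.

Definition reduction (A : 'M[E]_n.+2) :=
  exists X r, map_mx iota X = rho r /\ map_mx phi X = A.

Lemma reduction1 : reduction 1.
Proof. by exists 1, 1; rewrite !rmorph1. Qed.

Lemma reductionB A B : reduction A -> reduction B -> reduction (A - B).
Proof.
move=> [X [r [iX <-]]] [Y [s [iY <-]]]; exists (X - Y), (r - s).
by rewrite !map_mxB iX iY rmorphB.
Qed.

Lemma reductionM A B : reduction A -> reduction B -> reduction (A * B).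
Proof.
move=> [X [r [iX <-]]] [Y [s [iY <-]]]; exists (X * Y), (r * s).
by rewrite -!mulmxE !map_mxM iX iY rmorphM.
Qed.

(** The expressions of the matrix units are relations over C modulo the kernel of
    iota, so they persist over E. *)
Lemma reduction_span (Q : 'M[E]_n.+2 -> Prop) :
  (forall a A B, Q A -> Q B -> Q (a *: A + B)) -> Q 0 ->
  (forall A, reduction A -> Q A) -> forall A, Q A.
Proof.
move=> QD Q0 Qred.
have Qsum (J : eqType) (s : seq J) (c : J -> E) (B : J -> 'M_n.+2) :
    (forall j, j \in s -> Q (B j)) -> Q (\sum_(j <- s) c j *: B j).
  elim: s => [|j s IHs] QB; first by rewrite big_nil.
  rewrite big_cons; apply: QD; first by apply: QB; rewrite mem_head.
  by apply: IHs => l ls; apply: QB; rewrite mem_behead.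
suff Qdelta i j : Q (delta_mx i j).
  move=> A; rewrite (matrix_sum_delta A).
  rewrite pair_big /=; apply: (Qsum _ _ (fun p => A p.1 p.2) (fun p => delta_mx p.1 p.2)).
  by move=> [i j] _; apply: Qdelta.
pose D : 'M[C]_n.+2 := \sum_(p <- w i j) L p.1 *: map_mx L (rho p.2).
have LK p : p \in w i j -> mxi (map_mx L (rho p.2)) = rho p.2.
  by move=> pw; apply/matrixP => a b; rewrite !mxE (L_entry pw).
have -> : delta_mx i j = mxp D.
  transitivity (mxp (delta_mx i j)); first by rewrite /mxp map_delta_mx.
  apply: map_mx_ker; rewrite /mxi map_delta_mx w_delta raddf_sum /=.
  by apply: eq_big_seq => p pw; rewrite map_mxZ (L_coef pw) -/(mxi _) LK.
rewrite /mxp /D raddf_sum /=.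
under eq_bigr => p _ do rewrite map_mxZ.
apply: Qsum => p pw; apply: Qred.
by exists (map_mx L (rho p.2)), p.2; split=> //; apply: LK.
Qed.

(** Adding (tau^q - tau) tau^j to a lift changes nothing over E, as x^q = x there,
    and tau has pairwise distinct powers. *)
Lemma regular_lift A : reduction A -> exists X r,
  [/\ map_mx iota X = rho r, map_mx phi X = A & rho r \is a GRing.unit].
Proof.
move=> [X [r [iX pX]]]; pose q := #|E|; pose c := L tau.
have [|j uj] := @exists_unit_shift K n.+1 (rho r) (fun j => (tau ^+ q - tau) * tau ^+ j).
  move=> i j /mulfI /tau_nontorsion-> //.
  rewrite subr_eq0; apply/eqP; rewrite -[RHS]expr1 => /tau_nontorsion q1.
  by have := finNzRing_gt1 E; rewrite -/q q1.
exists (X + ((c ^+ q - c) * c ^+ j)%:M), (r + ((t ^+ q - t) * t ^+ j)%:A).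
have tauE : rho ((t ^+ q - t) * t ^+ j)%:A = ((tau ^+ q - tau) * tau ^+ j)%:M.
  have -> : ((t ^+ q - t) * t ^+ j)%:A = ((t ^+ q)%:A - t%:A) * (t ^+ j)%:A :> R.
    by rewrite -scalerBl mulr_algl scalerA.
  by rewrite rmorphM rmorphB !rho_tX rho_t scalar_mxM raddfB mulmxE.
rewrite rmorphD tauE; split=> //.
- rewrite map_mxD iX map_scalar_mx /= rmorphM rmorphB !rmorphXn /= /c.
  by rewrite L_tau.
- rewrite map_mxD pX map_scalar_mx /= rmorphM rmorphB !rmorphXn /=.
  by rewrite expf_card subrr mul0r raddf0 addr0.
Qed.

Lemma specialization_free_pair : contains_free_subsemigroup R.
Proof.
have [e [f [[Se Sf fe r_lt rf] rank_gg]]] :=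
  ping_pong_pair reduction1 reductionB reductionM reduction_span.
have [X [x [iX pX ux]]] := regular_lift Se.
have [Y [y [iY pY uy]]] := regular_lift Sf.
exists x, y => u v _ _ uv; apply: val_inj => /=.
pose Z (b : bool) := if b then X else Y.
pose z (b : bool) := if b then x else y.
pose g (b : bool) := if b then e else f.
have Zg b : map_mx phi (Z b) = g b by case: b.
have Zz b : map_mx iota (Z b) = rho (z b) by case: b.
apply: (@ping_pong_free E n g (\rank e) _ _ _ _ _ (fun b => rho (z b))).
- by case.
- by [].
- by move=> b c; apply: rank_gg; rewrite !inE /g; [case: b | case: c]; rewrite eqxx ?orbT.
- by [].
- by case.
- move=> s s' ss'.
  have prodi l : mxi (\prod_(i <- l) Z i) = \prod_(i <- l) rho (z i).
    by rewrite /mxi rmorph_prod; apply: eq_bigr => b _; apply: Zz.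
  have prodp l : mxp (\prod_(i <- l) Z i) = \prod_(i <- l) g i.
    by rewrite /mxp rmorph_prod; apply: eq_bigr => b _; apply: Zg.
  by rewrite -!prodp; apply: map_mx_ker; rewrite !prodi.
by rewrite -!rmorph_prod; congr (rho _).
Qed.
End Specialization.

Lemma free_pair : contains_free_subsemigroup R.
Proof.
have /choice[w w_delta] (ij : 'I_n.+2 * 'I_n.+2) := spanning (delta_mx ij.1 ij.2).
pose entries (A : 'M[K]_n.+2) := [seq A ab.1 ab.2 | ab : 'I_n.+2 * 'I_n.+2].
pose data (p : K * R) := p.1 :: entries (rho p.2).
pose xs := tau :: flatten [seq flatten (map data (w ij)) | ij : 'I_n.+2 * 'I_n.+2].
have [C [iota [E [phi [surj ker_phi]]]]] := finite_specialization xs.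
have /choice[L LK] x : exists c, x \in xs -> iota c = x.
  by have [/surj[c <-]|nx] := boolP (x \in xs); [exists c | exists 0].
have in_xs ij p x : p \in w ij -> x \in data p -> x \in xs.
  move=> pw xp; rewrite inE; apply/orP; right.
  apply/flatten_mapP; exists ij; first by rewrite mem_enum.
  by apply/flatten_mapP; exists p.
apply: (@specialization_free_pair C E iota phi ker_phi L (fun i j => w (i, j))).
- by move=> i j; apply: (w_delta (i, j)).
- by apply: LK; rewrite mem_head.
- by move=> i j p pw; apply/LK/(in_xs _ _ _ pw); rewrite mem_head.
- move=> i j p pw a b; apply/LK/(in_xs _ _ _ pw); rewrite inE; apply/orP; right.
  by apply/mapP; exists (a, b) => //; rewrite mem_enum.
Qed.
End FreePair.

Theorem mainTheorem1 (k : fieldType) (R : algType k) :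
  ~ algebraic_over_finite_subfield k ->
  satisfies_PI R ->
  noncommutative_modulo (@prime_radical R) ->
  contains_free_subsemigroup R.
Proof.
move=> /exists_nontorsion[t t_nontorsion] PI ncomm.
have [K [[|n] [rho [spanning [r [s rs]]]]]] := PI_matrix_representation PI ncomm.
  case/eqP: rs; rewrite !rmorphM (mx11_scalar (rho r)) (mx11_scalar (rho s)).
  by rewrite -!mulmxE scalar_mxC.
have [B|tau rho_t] := @central_matrix_scalar K n.+1 (rho t%:A).
  have [w ->] := spanning B; rewrite mulmx_sumr mulmx_suml; apply: eq_bigr => p _.
  rewrite -scalemxAr -scalemxAl mulmxE -!rmorphM.
  by rewrite mulr_algl mulr_algr.
exact: (free_pair spanning t_nontorsion rho_t).
Qed.
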